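(* Fix a non-constant function $f:\mathcal{X}^n\to\mathbb{R}_+$ and $p_0\in(1,\infty)$. Then there is a finite $t_0$ and a unique function $p(t)$ on $[0,t_0)$ satisfying $\|T_t^{\otimes n}f\|_{p(t)}=\|f\|_{p_0}$. This function is $C^\infty$-smooth, strictly increasing and surjective onto $[p_0,\infty)$ with $p(0)=p_0$. Furthermore, if the semigroup $T_t$ admits a $(p,\Phi_p)$-LSI for each $p\ge p_0$, then $$\frac{d}{dt}p(t)\ge\frac{p(t)(p(t)-1)}{\rho_0}\,b_{p(t)}\left(\frac{p(t)\rho_0}{p(t)-1}\right),\qquad \rho_0=\frac1n\ln\frac{\|f\|_{p_0}}{\|f\|_1}.$$
   Context: Setting: $\mathcal{X}$ is a finite set and $(L_{x,y})_{x,y\in\mathcal{X}}$ is a real matrix with $L_{x,y}\ge 0$ for $x\ne y$ and $\sum_{y}L_{x,y}=0$ for all $x$. $T_t=e^{tL}$, $t\ge0$, is the associated stochastic semigroup, acting by $(Lf)(x)=\sum_y L_{x,y}f(y)$, and $\pi$ is a stationary probability measure for it. The Dirichlet form is $\mathcal{E}(f,g)=-\sum_{x,y}L_{x,y}f(y)g(x)\pi(x)=\mathbb{E}_\pi[(-Lf)g]$. For a probability measure $\mu$ and $g\ge0$ put $\mathrm{Ent}_\mu(g)=\mathbb{E}_\mu\left[g\ln\frac{g}{\mathbb{E}_\mu[g]}\right]$ (natural logarithm, $0\ln 0=0$). For $n\ge1$, $\pi^n$ is the product measure on $\mathcal{X}^n$, $T_t^{\otimes n}$ is the product semigroup acting on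 functions on $\mathcal{X}^n$, and $\|f\|_p=(\mathbb{E}_{\pi^n}|f|^p)^{1/p}$. Non-linear LSI: for $p>1$ let $\Phi_p:[0,\infty)\to[0,\infty)$ be concave, continuous, non-negative with $\Phi_p(0)=0$. The semigroup $T_t$ admits a $(p,\Phi_p)$-LSI if $$\frac{\mathrm{Ent}_\pi(f^p)}{\mathbb{E}_\pi[f^p]}\le\Phi_p\left(\frac{\mathcal{E}(f,f^{p-1})}{\mathbb{E}_\pi[f^p]}\right)$$ for all $f:\mathcal{X}\to\mathbb{R}_+$ (for which the ratios are defined). Given $\Phi_p$, the function $b_p:[0,\infty)\to[0,\infty]$ is defined by $b_p(y)=\inf\{x:\Phi_p(x)\ge y\}$, with $\inf\emptyset=\infty$; it is convex and increasing with $b_p(0)=0$.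
   Formalization: L is assumed irreducible (for L=0, p(t) is constant, so the claim fails). Smoothness is C^∞ on (0,t_0) and C^1 on [0,t_0), and C^∞ up to t=0 only when f>0, since if f vanishes somewhere p(t) need not be smooth at 0. *)

(* Defs.v *)
From HB Require Import structures.
From mathcomp Require Import all_boot all_order all_algebra.
From mathcomp Require Import all_classical all_reals all_analysis.
Set Implicit Arguments.
Unset Strict Implicit.
Unset Printing Implicit Defensive.
Import Order.TTheory GRing.Theory Num.Theory.
Import numFieldNormedType.Exports.
Local Open Scope classical_set_scope.
Local Open Scope ring_scope.

Section FiniteProbability.
Context {R : realType} {T : finType}.
Implicit Types (mu g : T -> R) (p : R).

Definition is_prob mu := (forall x, 0 <= mu x) /\ \sum_x mu x = 1.

Definition expect mu g : R := \sum_x mu x * g x.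

(* The library's [ln 0 = 0] and [0^-1 = 0] give the convention 0 ln 0 = 0. *)
Definition entropy mu g : R := expect mu (fun x => g x * ln (g x / expect mu g)).

Definition pnorm mu p g : R := (expect mu (fun x => `|g x| `^ p)) `^ p^-1.

End FiniteProbability.

Section Semigroup.
Context {R : realType} {X : finType}.
Implicit Types (L : X -> X -> R) (mu : X -> R).

Definition is_generator L :=
  (forall x y, x != y -> 0 <= L x y) /\ (forall x, \sum_y L x y = 0).

Definition irreducible L := forall x y, connect (fun u v => 0 < L u v) x y.

Fixpoint genpow L (k : nat) (x y : X) : R :=
  if k is k'.+1 then \sum_z L x z * genpow L k' z y else (x == y)%:R.

(* The (x, y) entry of exp (t L); [exp_coeff t k] is t ^ k / k!. *)
Definition heat L (t : R) (x y : X) : R :=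
  limn (series (fun k => exp_coeff t k * genpow L k x y)).

Definition stationary L mu :=
  forall t, 0 <= t -> forall y, \sum_x mu x * heat L t x y = mu y.

Definition prod_measure (n : nat) mu (x : {ffun 'I_n -> X}) : R :=
  \prod_(i < n) mu (x i).

Definition prod_semigroup (n : nat) L (t : R) (f : {ffun 'I_n -> X} -> R)
    (x : {ffun 'I_n -> X}) : R :=
  \sum_(y : {ffun 'I_n -> X}) (\prod_(i < n) heat L t (x i) (y i)) * f y.

Definition dirichlet L mu (f g : X -> R) : R :=
  - \sum_x \sum_y L x y * f y * g x * mu x.

End Semigroup.

Section LogSobolev.
Context {R : realType} {X : finType}.
Implicit Types (L : X -> X -> R) (mu : X -> R) (p : R) (Phi : R -> R).

(* Only the values of [Phi] on [0, +oo[ matter. *)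
Definition lsi_gauge Phi :=
  [/\ convex_function (`[0, +oo[%classic : set R^o) (fun x => - Phi x),
      {within `[0, +oo[, continuous Phi},
      (forall x, 0 <= x -> 0 <= Phi x) & Phi 0 = 0].

Definition admits_lsi L mu p Phi :=
  forall g : X -> R, (forall x, 0 <= g x) ->
    let gp := fun x => g x `^ p in
    expect mu gp != 0 ->
    entropy mu gp / expect mu gp <=
      Phi (dirichlet L mu g (fun x => g x `^ (p - 1)) / expect mu gp).

(* The generalized inverse of [Phi]; it equals +oo when the set is empty. *)
Definition lsi_inverse Phi (y : R) : \bar R :=
  ereal_inf [set x%:E | x in [set x : R | 0 <= x /\ y <= Phi x]].

End LogSobolev.

Section Smoothness.
Context {R : realType}.
Implicit Types (I : set R) (g : R -> R) (t : R).

(* Derivatives relative to an interval [I]: two-sided at interior points,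
   one-sided at an endpoint of [I] that belongs to [I]. *)
Definition within_quotient I g t (s : R) : R := (g s - g t) / (s - t).

Definition derivable_within I g t :=
  cvg (within_quotient I g t s @[s --> within I t^']).

Definition derive_within I g t : R :=
  lim (within_quotient I g t s @[s --> within I t^']).

Fixpoint Ck_on (k : nat) I g : Prop :=
  if k is k'.+1 then
    (forall t, I t -> derivable_within I g t) /\ Ck_on k' I (derive_within I g)
  else {within I, continuous g}.

Definition smooth_on I g := forall k, Ck_on k I g.

End Smoothness.

(* Main.v *)
Require Import Defs.
From HB Require Import structures.
From mathcomp Require Import all_boot all_order all_algebra.
From mathcomp Require Import all_classical all_reals all_analysis.
From mathcomp Require Import ring lra.
Set Implicit Arguments.
Unset Strict Implicit.
Unset Printing Implicit Defensive.
Import Order.TTheory GRing.Theory Num.Theory.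
Import numFieldNormedType.Exports.
Local Open Scope classical_set_scope.
Local Open Scope ring_scope.

(** Divide [f] by c = ||f||_p0 and let u t be the evolution of f / c, so that the
    equation ||T_t f||_p(t) = c becomes N(t, p(t)) = 1 for the moment
    N(t, q) = E[(u t)^q].

    Existence, uniqueness, monotonicity.  Two strict inequalities, both instances
    of Jensen's inequality for a power ([powR_mean_lt]), carry everything: for a
    nonconstant function a moment that is at least 1 becomes larger than 1 when
    the exponent grows ([moment_gt1]), and N(t, q) is strictly decreasing in t
    because T_t is averaging against a positive kernel that preserves the
    product measure ([moment_kernel_lt]).  By Doeblin's contraction
    ([kernel_contraction]) u t falls uniformly below 1 after a finite time, so
    each q >= p0 has a time at which N(., q) = 1 ([hitting_time]).  The horizon
    t0 is the supremum of these times; the intermediate value theorem in q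
    gives p(t) for t < t0, and p is strictly increasing and onto, hence
    continuous ([exponent_exists], [exponent_continuous]).

    Regularity.  Implicit differentiation gives p' = - N_t / N_q at (t, p(t)).
    It is carried out with the mean value theorem in each variable separately,
    which works also at t = 0 where f may vanish, because a^q and a^q ln a are
    jointly continuous for a >= 0, q > 0 ([exponent_slope]).  N_q is positive
    since, up to a factor, it is the entropy of a nonconstant function.  Where
    u > 0, the formula for p' is smooth in p and u, and a bootstrap gives all
    derivatives ([exponent_smooth]).

    The differential inequality.  Write p' = p D / l with D the product
    Dirichlet form E(u, u^(p-1)) and l = E[u^p ln u], so that Ent(u^p) = p l.
    The one-site inequality tensorizes ([lsi_tensorization]): with H = p l / n
    and x = D / n, H <= Phi_p(x).  On the other hand convexity of
    s |-> ln E[u^s], together with E[u] = ||f||_1 / c, gives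
    H >= p rho0 / (p - 1) ([log_moment_ge]).  Concavity of Phi_p and
    Phi_p(0) = 0 then give b_p(y) <= x y / H for 0 < y <= H
    ([lsi_inverse_le]), and y = p rho0 / (p - 1) is the claim since
    p' = p^2 x / H ([velocity_lower_bound]). *)

(** * Power functions and Jensen's inequality *)

Section PowerFunctions.
Context {R : realType}.
Implicit Types a b p q : R.

Lemma powR_tangent_lt a b p : 0 <= a -> 0 <= b -> 1 < p -> a != b ->
  p * a `^ (p - 1) * (b - a) < b `^ p - a `^ p.
Proof.
move=> a0 b0 p1 ab; have p0 : 0 < p by lra.
have [az|an0] := eqVneq a 0.
  have bgt0 : 0 < b by rewrite lt_neqAle b0 andbT -az.
  rewrite az.
  rewrite !powR0 ?subr0; [|by lra|by lra].
  by rewrite mulr0 mul0r powR_gt0.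
have agt0 : 0 < a by rewrite lt_neqAle a0 andbT eq_sym.
rewrite -(mulr_powRB1 a0 p0); set A := a `^ (p - 1).
have Agt0 : 0 < A by rewrite powR_gt0.
have [->|bn0] := eqVneq b 0.
  rewrite powR0 ?gt_eqF// sub0r.
  have : 0 < a * A by rewrite mulr_gt0.
  by nra.
have bgt0 : 0 < b by rewrite lt_neqAle b0 andbT eq_sym.
(* With b = a e^r, divide by a^p e^r and use e^x > 1 + x twice. *)
set r := ln b - ln a.
have rn0 : r != 0.
  rewrite subr_eq0; apply: contraNneq ab => /ln_inj-> //; by rewrite posrE.
have bE : b = a * expR r.
  by rewrite /r expRB !lnK ?posrE// mulrCA divff ?mulr1.
have BE : b `^ (p - 1) = A * expR ((p - 1) * r).
  by rewrite bE powRM// ?expR_ge0// [expR r `^ _]/powR gt_eqF ?expR_gt0// expRK.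
rewrite -(mulr_powRB1 b0 p0) BE {2}bE.
have h1 : 1 + (p - 1) * r < expR ((p - 1) * r).
  by apply: expR_gt1Dx; rewrite mulf_neq0// subr_eq0 gt_eqF.
have h2 : 1 + - r < expR (- r) by apply: expR_gt1Dx; rewrite oppr_eq0.
have h3 : expR r * expR (- r) = 1 by rewrite expRxMexpNx_1.
have er : 0 < expR r by rewrite expR_gt0.
rewrite bE -subr_gt0.
have -> : a * expR r * (A * expR ((p - 1) * r)) - a * A -
  p * A * (a * expR r - a) =
  a * A * (expR r * (expR ((p - 1) * r) + (p - 1) * expR (- r) - p)).
  have -> : expR r * (expR ((p - 1) * r) + (p - 1) * expR (- r) - p) =
    expR r * expR ((p - 1) * r) + (p - 1) * (expR r * expR (- r)) - p * expR r.
    by ring.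
  by rewrite h3; ring.
by rewrite !mulr_gt0//; nra.
Qed.

Lemma powR_tangent_le a b p : 0 <= a -> 0 <= b -> 1 < p ->
  p * a `^ (p - 1) * (b - a) <= b `^ p - a `^ p.
Proof.
move=> a0 b0 p1; have [->|/powR_tangent_lt ab] := eqVneq a b; last exact/ltW/ab.
by rewrite !subrr mulr0.
Qed.

Lemma is_derive_powR_exponent a p : 0 <= a -> 0 < p ->
  is_derive p (1 : R) (fun q => a `^ q) (a `^ p * ln a).
Proof.
move=> a0 p0; have [->|an0] := eqVneq a 0.
  rewrite ln0 ?lexx// mulr0.
  have e : \forall q \near p, (cst 0 : R -> R) q = 0 `^ q.
    near=> q; rewrite /= powR0// gt_eqF//; near: q; exact: lt_nbhsr.
  apply: (near_eq_is_derive e); exact: is_derive_cst.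
have -> : (fun q => a `^ q) = expR \o (fun q => q * ln a).
  by apply/funext => q /=; rewrite /powR (negbTE an0).
have -> : a `^ p * ln a = expR (p * ln a) * ln a by rewrite /powR (negbTE an0).
apply: is_derive1_comp.
have -> : (fun q => q * ln a) = ln a \*: (@idfun R) by apply/funext => q /=; rewrite mulrC.
by apply: is_derive_eq; rewrite scaler1.
Unshelve. all: by end_near.
Qed.

Lemma cvg_expR {I : Type} (F : set_system I) {FF : Filter F} (f : I -> R) a :
  f i @[i --> F] --> a -> expR (f i) @[i --> F] --> expR a.
Proof. exact: (continuous_cvg FF (@continuous_expR R a)). Qed.

Lemma cvg_ln {I : Type} (F : set_system I) {FF : Filter F} (f : I -> R) a :
  0 < a -> f i @[i --> F] --> a -> ln (f i) @[i --> F] --> ln a.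
Proof. by move=> a0; apply: (continuous_cvg FF (continuous_ln a0)). Qed.

(** At a base [a0 = 0] the exponent can be frozen, as a ^ q <= a ^ (q0 / 2) for
    small a; away from 0 the power is exp (q ln a). *)
Lemma cvg_powR {I : Type} (F : set_system I) {FF : Filter F} (a q : I -> R) a0 q0 :
  0 < q0 -> 0 <= a0 -> (\forall i \near F, 0 <= a i) ->
  a i @[i --> F] --> a0 -> q i @[i --> F] --> q0 ->
  a i `^ q i @[i --> F] --> a0 `^ q0.
Proof.
move=> q0gt0; rewrite le_eqVlt => /predU1P[<-|a0gt0] a_ge0 ha hq; last first.
  have -> : a0 `^ q0 = expR (q0 * ln a0) by rewrite /powR gt_eqF.
  apply: (@cvg_trans _ (expR (q i * ln (a i)) @[i --> F])).
    apply: near_eq_cvg; near=> i; rewrite /powR gt_eqF//.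
    by near: i; apply: cvgr_gt ha _ a0gt0.
  by apply: cvg_expR; apply: cvgM => //; exact: cvg_ln.
rewrite powR0 ?gt_eqF//; apply/cvgrPdist_lt => e e0.
have r0 : 0 < q0 / 2 by lra.
pose d := Num.min 1 (e `^ (q0 / 2)^-1).
have d0 : 0 < d by rewrite lt_min ltr01 powR_gt0.
near=> i.
have ai0 : 0 <= a i by near: i.
have aid : a i < d by near: i; apply: cvgr_lt ha _ d0.
have qi : q0 / 2 < q i by near: i; apply: cvgr_gt hq _ _; lra.
rewrite sub0r normrN ger0_norm ?powR_ge0//.
move: aid; rewrite lt_min => /andP[ai1 aie].
apply: (@le_lt_trans _ _ (a i `^ (q0 / 2))).
  have [->|an0] := eqVneq (a i) 0; first by rewrite !powR0 ?gt_eqF// (lt_trans r0).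
  by apply: ger_powR; [rewrite lt_neqAle eq_sym an0 ai0 ltW|exact: ltW].
have -> : e = (e `^ (q0 / 2)^-1) `^ (q0 / 2).
  by rewrite -powRrM mulVf ?gt_eqF// powRr1 ?ltW.
by apply: gt0_ltr_powR; rewrite ?nnegrE ?powR_ge0.
Unshelve. all: by end_near.
Qed.

(** With x = a ^ (q / 2), this is ln (1 / x) <= 1 / x. *)
Lemma powR_ln_bound a q : 0 <= a <= 1 -> 0 < q ->
  `|a `^ q * ln a| <= 2 / q * a `^ (q / 2).
Proof.
move=> /andP[]; rewrite le_eqVlt => /predU1P[<- _ q0|a0 a1 q0].
  by rewrite ln0// mulr0 normr0 mulr_ge0 ?powR_ge0// divr_ge0// ltW.
set x := a `^ (q / 2); have x0 : 0 < x by rewrite powR_gt0.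
have -> : a `^ q = x * x.
  by rewrite /x -powRD ?(gt_eqF a0) ?implybT//; congr powR; lra.
have lx : ln x = q / 2 * ln a by rewrite ln_powR.
have la : ln a <= 0 by rewrite ln_le0.
have hx : - ln x <= x^-1.
  by rewrite -lnV ?posrE// ltW// ln_sublinear// invr_gt0.
rewrite ler0_norm; last by rewrite mulr_ge0_le0// ltW// mulr_gt0.
have -> : - (x * x * ln a) = (2 / q * x) * (x * - ln x).
  by rewrite lx; field; lra.
rewrite -[leRHS]mulr1 ler_wpM2l//.
  by rewrite mulr_ge0 ?divr_ge0// ltW.
by rewrite -(divff (lt0r_neq0 x0)) ler_wpM2l// ltW.
Qed.

Lemma cvg_powR_ln {I : Type} (F : set_system I) {FF : Filter F} (a q : I -> R) a0 q0 :
  0 < q0 -> 0 <= a0 -> (\forall i \near F, 0 <= a i) ->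
  a i @[i --> F] --> a0 -> q i @[i --> F] --> q0 ->
  a i `^ q i * ln (a i) @[i --> F] --> a0 `^ q0 * ln a0.
Proof.
move=> q0gt0; rewrite le_eqVlt => /predU1P[<-|a0gt0] a_ge0 ha hq; last first.
  apply: cvgM; first by apply: cvg_powR => //; exact: ltW.
  exact: cvg_ln.
have h2 : 0 < q0 / 2 by lra.
rewrite ln0// mulr0; apply: norm_cvg0.
have hup : 2 / q i * a i `^ (q i / 2) @[i --> F] --> (0 : R).
  rewrite -(mulr0 (2 / q0)) -(powR0 (lt0r_neq0 h2)).
  apply: cvgM; first by apply: cvgMl_tmp; apply: cvgV => //; rewrite gt_eqF.
  by apply: cvg_powR => //; exact: cvgMr_tmp.
apply: squeeze_cvgr (cvg_cst 0) hup.
near=> i; rewrite normr_ge0 powR_ln_bound//.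
  apply/andP; split; near: i => //.
  by apply: cvgr_le ha _ _; exact: ltr01.
by near: i; apply: cvgr_gt hq _ q0gt0.
Unshelve. all: by end_near.
Qed.

End PowerFunctions.

Lemma ltr_sum_point (R : numDomainType) (T : finType) (z : T) (F G : T -> R) :
  (forall x, F x <= G x) -> F z < G z -> \sum_x F x < \sum_x G x.
Proof.
move=> FG FGz; rewrite (bigD1 z)//= [ltRHS](bigD1 z)//= ltr_leD//.
exact: ler_sum.
Qed.

Section Jensen.
Context {R : realType} {T : finType}.
Implicit Types w h : T -> R.

Lemma nonconst_neq h : ~ (exists c, forall x, h x = c) -> forall c, exists x, h x != c.
Proof.
move=> hn c; apply: contrapT => nx; apply: hn; exists c => x.
by apply: contrapT => hx; apply: nx; exists x; apply/eqP.
Qed.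

(** Integrate the tangent line of x ^ q at the mean of [h], which is strict
    wherever [h] differs from its mean. *)
Lemma powR_mean_lt w h q : (forall x, 0 < w x) -> \sum_x w x = 1 ->
  (forall x, 0 <= h x) -> ~ (exists c, forall x, h x = c) -> 1 < q ->
  expect w h `^ q < expect w (fun x => h x `^ q).
Proof.
move=> w0 w1 h0 hn q1; set m := expect w h.
have m0 : 0 <= m by apply: sumr_ge0 => x _; rewrite mulr_ge0// ltW.
have [z hz] := nonconst_neq hn m.
have : \sum_x w x * (q * m `^ (q - 1) * (h x - m)) <
       \sum_x w x * (h x `^ q - m `^ q).
  apply: (@ltr_sum_point _ _ z) => [x|].
    by rewrite ler_wpM2l ?(ltW (w0 x))// powR_tangent_le.
  by rewrite ltr_pM2l// powR_tangent_lt// eq_sym.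
under eq_bigr do rewrite mulrCA.
under [ltRHS]eq_bigr do rewrite mulrBr.
have -> : \sum_x q * m `^ (q - 1) * (w x * (h x - m)) = 0.
  rewrite -mulr_sumr; under eq_bigr do rewrite mulrBr.
  by rewrite sumrB -mulr_suml w1 mul1r subrr mulr0.
by rewrite sumrB -mulr_suml w1 mul1r subr_gt0.
Qed.

End Jensen.

(** * Derivatives relative to an interval and the classes C^k *)

Section FiniteSums.
Context {R : realType}.

Lemma cvg_sum_seq {J T : Type} (F : set_system J) {FF : Filter F} (r : seq T)
    (f : T -> J -> R) (l : T -> R) :
  (forall x, f x j @[j --> F] --> l x) ->
  \sum_(x <- r) f x j @[j --> F] --> \sum_(x <- r) l x.
Proof.
move=> fl; elim: r => [|x r IH].
  by under eq_fun do rewrite big_nil; rewrite big_nil; exact: cvg_cst.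
by under eq_fun do rewrite big_cons; rewrite big_cons; exact: cvgD.
Qed.

Lemma is_derive_sum_seq {T : Type} (r : seq T) (f : T -> R -> R) (d : T -> R) (t : R) :
  (forall x, is_derive t (1 : R) (f x) (d x)) ->
  is_derive t (1 : R) (fun s => \sum_(x <- r) f x s) (\sum_(x <- r) d x).
Proof.
move=> fd; elim: r => [|x r IH].
  by under eq_fun do rewrite big_nil; rewrite big_nil; exact: is_derive_cst.
by under eq_fun do rewrite big_cons; rewrite big_cons; exact: is_deriveD.
Qed.

Lemma is_derive_scale (k : R) (f : R -> R) (t d : R) :
  is_derive t (1 : R) f d -> is_derive t (1 : R) (fun s => k * f s) (k * d).
Proof. by move=> fd; exact: is_deriveZ. Qed.

Lemma is_derive_continuous (f : R -> R) (t d : R) :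
  is_derive t (1 : R) f d -> {for t, continuous f}.
Proof. by move=> [/derivable1_diffP/differentiable_continuous]. Qed.

End FiniteSums.

Lemma near_within_mem {R : realType} (I : set R) (t : R) :
  \forall s \near within I (nbhs t), I s.
Proof. exact: (@withinT _ (nbhs t) I _). Qed.

Lemma near_within_punctured {R : realType} (I : set R) (t : R) :
  \forall s \near within I t^', I s /\ s != t.
Proof.
apply: filterI; first exact: (@withinT _ t^' I _).
by apply: cvg_within; exact: (@withinT _ (nbhs t) [set s | s != t] _).
Qed.

Section WithinDerivative.
Context {R : realType} (I : set R).
Implicit Types (f g h d : R -> R) (t s : R).

(** Caratheodory's form of the derivative relative to [I]: the slope function
    extends continuously to [t] with value [c].  Products and compositions are
    algebraic identities between slopes. *)
Definition has_slope g t (c : R) := exists2 phi : R -> R,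
  forall s, I s -> g s - g t = phi s * (s - t) &
  phi s @[s --> within I (nbhs t)] --> c.

Lemma has_slope_cont g t c : has_slope g t c ->
  g s @[s --> within I (nbhs t)] --> g t.
Proof.
move=> [phi phiE phic].
apply: (@cvg_trans _ (g t + phi s * (s - t) @[s --> within I (nbhs t)])).
  apply: near_eq_cvg; apply: filterS (near_within_mem I t) => s Is /=.
  by rewrite -(phiE s Is) addrC subrK.
suff : g t + phi s * (s - t) @[s --> within I (nbhs t)] --> g t + c * (t - t).
  by rewrite subrr mulr0 addr0.
apply: cvgD; first exact: cvg_cst.
apply: cvgM => //; apply: cvgB; last exact: cvg_cst.
exact: cvg_within_filter cvg_id.
Qed.

Lemma has_slopeD f g t c e : has_slope f t c -> has_slope g t e ->
  has_slope (fun s => f s + g s) t (c + e).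
Proof.
move=> [phi phiE phic] [psi psiE psie]; exists (fun s => phi s + psi s).
  by move=> s Is; rewrite opprD addrACA phiE// psiE// mulrDl.
exact: cvgD.
Qed.

Lemma has_slopeM f g t c e : has_slope f t c -> has_slope g t e ->
  has_slope (fun s => f s * g s) t (c * g t + f t * e).
Proof.
move=> fc [psi psiE psie]; have fcont := has_slope_cont fc.
have [phi phiE phic] := fc.
exists (fun s => phi s * g t + f s * psi s); last first.
  by apply: cvgD; [exact: cvgMr_tmp|exact: cvgM].
move=> s Is; rewrite mulrDl mulrAC -phiE// -mulrA -psiE//; ring.
Qed.

Lemma has_slope_cst k t : has_slope (fun=> k) t 0.
Proof. by exists (fun=> 0); [move=> s _; rewrite subrr mul0r|exact: cvg_cst]. Qed.

Lemma has_slope_comp h g t c e : has_slope g t c -> is_derive (g t) (1 : R) h e ->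
  has_slope (fun s => h (g s)) t (e * c).
Proof.
move=> gc /is_derive1_caratheodory[psi [psiE psic <-]].
have gcont := has_slope_cont gc; have [phi phiE phic] := gc.
exists (fun s => psi (g s) * phi s) => [s Is|].
  by rewrite psiE phiE// mulrA.
by apply: cvgM => //; apply: (continuous_cvg _ psic).
Qed.

Lemma has_slope_derive g t c : is_derive t (1 : R) g c -> has_slope g t c.
Proof.
move=> /is_derive1_caratheodory[psi [psiE psic <-]]; exists psi => //.
exact: cvg_within_filter psic.
Qed.

Lemma has_slope_ext f g t c : (forall s, I s -> f s = g s) -> I t ->
  has_slope f t c -> has_slope g t c.
Proof. by move=> fg It [phi phiE ?]; exists phi => // s Is; rewrite -!fg// phiE. Qed.

Hypothesis I_limit : forall t, I t -> ProperFilter (within I t^').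

Lemma within_quotient_cvgP g t c : I t ->
  within_quotient I g t s @[s --> within I t^'] --> c <-> has_slope g t c.
Proof.
move=> It; split=> [qc|[phi phiE phic]].
  exists (fun s => if s == t then c else within_quotient I g t s).
    move=> s Is; case: eqVneq => [->|st]; first by rewrite !subrr mulr0.
    by rewrite divfK// subr_eq0.
  move=> A cA.
  have qA : nbhs t [set s | s != t -> I s -> A (within_quotient I g t s)] := qc A cA.
  change (nbhs t [set s | I s -> A (if s == t then c else within_quotient I g t s)]).
  apply: filterS qA => s qs Is; case: eqVneq => [_|st]; last exact: qs.
  exact: nbhs_singleton.
apply: (@cvg_trans _ (phi s @[s --> within I t^'])).
  apply: near_eq_cvg; apply: filterS (near_within_punctured I t) => s [Is st] /=.
  by rewrite /within_quotient phiE// mulfK// subr_eq0.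
apply: cvg_trans phic; apply: cvg_app => A.
change (nbhs t [set s | I s -> A s] -> nbhs t [set s | s != t -> I s -> A s]).
by apply: filterS => s sA _.
Qed.

Lemma has_slope_derive_within g t c : I t -> has_slope g t c ->
  derivable_within I g t /\ derive_within I g t = c.
Proof.
move=> It /(within_quotient_cvgP _ _ It) gc; have FP := I_limit It; split.
  by apply/cvg_ex; exists c.
exact: cvg_lim gc.
Qed.

Lemma derivable_within_slope g t : I t -> derivable_within I g t ->
  has_slope g t (derive_within I g t).
Proof. by move=> It gt; apply/within_quotient_cvgP. Qed.

Lemma C0P g : Ck_on 0 I g <->
  forall t, I t -> g s @[s --> within I (nbhs t)] --> g t.
Proof. exact: subspace_continuousP. Qed.

Lemma Ck_ext k f g : (forall t, I t -> f t = g t) -> Ck_on k I f -> Ck_on k I g.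
Proof.
elim: k f g => [|k IH] f g fg /=.
  move=> /C0P fc; apply/C0P => t It.
  rewrite -fg//; apply: cvg_trans (fc t It); apply: near_eq_cvg.
  by apply: filterS (near_within_mem I t) => s Is /=; rewrite fg.
move=> [fd fC].
have gd t : I t -> has_slope g t (derive_within I f t).
  by move=> It; apply: (has_slope_ext fg It); exact: derivable_within_slope It (fd t It).
split=> [t It|]; first by have [] := has_slope_derive_within It (gd t It).
by apply: IH fC => t It; have [] := has_slope_derive_within It (gd t It).
Qed.

Lemma CkSP k g : Ck_on k.+1 I g <->
  exists2 d, forall t, I t -> has_slope g t (d t) & Ck_on k I d.
Proof.
split=> [[gd gC]|[d gd dC]].
  by exists (derive_within I g) => // t It; exact: derivable_within_slope It (gd t It).
split=> [t It|]; first by have [] := has_slope_derive_within It (gd t It).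
by apply: Ck_ext dC => t It; have [] := has_slope_derive_within It (gd t It).
Qed.

Lemma Ck_cont g : (forall t, I t -> exists c, has_slope g t c) -> Ck_on 0 I g.
Proof.
by move=> gs; apply/C0P => t /gs[c]; exact: has_slope_cont.
Qed.

Lemma CkW k g : Ck_on k.+1 I g -> Ck_on k I g.
Proof.
elim: k g => [|k IH] g /CkSP[d gd dC].
  by apply: Ck_cont => t It; exists (d t); exact: gd.
by apply/CkSP; exists d => //; exact: IH.
Qed.

Lemma Ck_cst k c : Ck_on k I (fun=> c).
Proof.
elim: k c => [|k IH] c; first by apply: continuous_subspaceT; exact: cst_continuous.
by apply/CkSP; exists (fun=> 0) => // t _; exact: has_slope_cst.
Qed.

Lemma CkD k f g : Ck_on k I f -> Ck_on k I g -> Ck_on k I (fun t => f t + g t).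
Proof.
elim: k f g => [|k IH] f g.
  move=> /C0P fc /C0P gc.
  by apply/C0P => t It; apply: cvgD; [exact: fc|exact: gc].
move=> /CkSP[d fd dC] /CkSP[e ge eC]; apply/CkSP.
exists (fun t => d t + e t); last exact: IH.
by move=> t It; apply: has_slopeD; [exact: fd|exact: ge].
Qed.

Lemma CkM k f g : Ck_on k I f -> Ck_on k I g -> Ck_on k I (fun t => f t * g t).
Proof.
elim: k f g => [|k IH] f g.
  move=> /C0P fc /C0P gc.
  by apply/C0P => t It; apply: cvgM; [exact: fc|exact: gc].
move=> fC gC; have /CkSP[d fd dC] := fC; have /CkSP[e ge eC] := gC; apply/CkSP.
exists (fun t => d t * g t + f t * e t).
  by move=> t It; apply: has_slopeM; [exact: fd|exact: ge].
by apply: CkD; apply: IH => //; exact: CkW.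
Qed.

Lemma Ck_sum k (T : Type) (r : seq T) (F : T -> R -> R) :
  (forall x, Ck_on k I (F x)) -> Ck_on k I (fun t => \sum_(x <- r) F x t).
Proof.
move=> FC; elim: r => [|x r IH].
  by apply: Ck_ext (Ck_cst k 0) => t _; rewrite big_nil.
by apply: Ck_ext (CkD (FC x) IH) => t _; rewrite big_cons.
Qed.

(** The induction step shared by exp, ln and the inverse: their derivatives along
    [g] are again built from [g] and the composite, already known to be C^k. *)
Lemma Ck_comp k h e g : (forall t, I t -> is_derive (g t) (1 : R) h (e t)) ->
  Ck_on k I e -> Ck_on k.+1 I g -> Ck_on k.+1 I (fun t => h (g t)).
Proof.
move=> he eC /CkSP[d gd dC]; apply/CkSP; exists (fun t => e t * d t).
  by move=> t It; apply: has_slope_comp; [exact: gd|exact: he].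
exact: CkM.
Qed.

Lemma C0_comp h g : (forall t, I t -> {for g t, continuous h}) ->
  Ck_on 0 I g -> Ck_on 0 I (fun t => h (g t)).
Proof.
move=> hc /C0P gc; apply/C0P => t It.
by apply: (continuous_cvg _ (hc t It)); exact: gc.
Qed.

Lemma Ck_expR k g : Ck_on k I g -> Ck_on k I (fun t => expR (g t)).
Proof.
elim: k g => [|k IH] g gC.
  by apply: C0_comp gC => t _; exact: continuous_expR.
apply: (Ck_comp (e := fun t => expR (g t)) _ _ gC); exact/IH/CkW.
Qed.

Lemma Ck_inv k g : (forall t, I t -> g t != 0) -> Ck_on k I g ->
  Ck_on k I (fun t => (g t)^-1).
Proof.
move=> g0; elim: k => [|k IH] gC.
  apply: (C0_comp (h := fun x => x^-1)) gC => t /g0 gt0; exact: inv_continuous.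
have iC := IH (CkW gC).
apply: (Ck_comp (h := fun x => x^-1) (e := fun t => -1 * ((g t)^-1 * (g t)^-1))) gC.
  move=> t /g0 gt0; apply: is_derive_eq; first exact: is_deriveV.
  by rewrite scaler1 mulN1r expr2 invfM.
by apply: CkM; [exact: Ck_cst|exact: CkM].
Qed.

Lemma Ck_ln k g : (forall t, I t -> 0 < g t) -> Ck_on k I g ->
  Ck_on k I (fun t => ln (g t)).
Proof.
move=> g0; case: k => [|k] gC.
  by apply: C0_comp gC => t /g0 gt0; exact: continuous_ln.
apply: (Ck_comp (e := fun t => (g t)^-1) _ _ gC) => [t /g0 gt0|].
  exact: is_derive1_ln.
by apply: Ck_inv (CkW gC) => t /g0; exact: lt0r_neq0.
Qed.

End WithinDerivative.

Lemma has_slope_sub {R : realType} (I J : set R) (g : R -> R) (t c : R) :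
  J `<=` I -> has_slope I g t c -> has_slope J g t c.
Proof.
move=> JI [phi phiE phic]; exists phi; first by move=> s /JI; exact: phiE.
apply: cvg_trans phic; apply: cvg_app => A.
change (nbhs t [set s | I s -> A s] -> nbhs t [set s | J s -> A s]).
by apply: filterS => s As /JI.
Qed.

Lemma interval_limit_point {R : realType} (a b t : R) (J : set R) :
  `]a, b[ `<=` J -> a <= t < b -> ProperFilter (within J t^').
Proof.
move=> abJ /andP[a_t tb].
apply: Build_ProperFilter_ex => A JA.
have {}JA : nbhs t [set s | s != t -> J s -> A s] := JA.
have hJ : \forall s \near t^'+, s != t -> J s -> A s.
  by apply: cvg_within; exact: JA.
have hb : \forall s \near t^'+, s < b by exact: nbhs_right_lt.
have ht : \forall s \near t^'+, t < s by exact: nbhs_right_gt.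
have [s [[hs sb] ts]] := @filter_ex _ _ (at_right_proper_filter t) _ (filterI (filterI hJ hb) ht).
exists s; apply: hs; first by rewrite gt_eqF.
by apply: abJ; rewrite /= in_itv/= sb andbT (le_lt_trans a_t).
Qed.

(** * Moments along a flow and the exponent curve *)

Section Moments.
Context {R : realType} {T : finType} (w : T -> R).
Hypotheses (w_gt0 : forall x, 0 < w x) (w_sum : \sum_x w x = 1).
Implicit Types (h : T -> R) (r s : R).

Definition moment r h : R := expect w (fun x => h x `^ r).

Lemma moment_ge0 r h : 0 <= moment r h.
Proof. by apply: sumr_ge0 => x _; rewrite mulr_ge0 ?powR_ge0 ?ltW. Qed.

Lemma moment_le1 r h : 0 < r -> (forall x, 0 <= h x <= 1) -> moment r h <= 1.
Proof.
move=> r0 h01; rewrite -w_sum; apply: ler_sum => x _.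
have /andP[h0 h1] := h01 x; rewrite ler_piMr ?(ltW (w_gt0 x))//.
apply: (@le_trans _ _ (1 `^ r)); last by rewrite powR1.
by apply: ge0_ler_powR; rewrite ?nnegrE ?(ltW r0).
Qed.

(** Strict monotonicity of the L^r norms, as Jensen for [h ^ r] and the
    exponent [s / r]. *)
Lemma moment_lt r s h : (forall x, 0 <= h x) -> ~ (exists c, forall x, h x = c) ->
  0 < r < s -> moment r h `^ (s / r) < moment s h.
Proof.
move=> h0 hn /andP[r0 rs].
have rn0 : r != 0 by rewrite gt_eqF.
have -> : moment s h = expect w (fun x => (h x `^ r) `^ (s / r)).
  by apply: eq_bigr => x _; rewrite -powRrM mulrCA divff ?mulr1.
apply: powR_mean_lt => //; last by rewrite ltr_pdivlMr// mul1r.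
  by move=> x; exact: powR_ge0.
move=> [c hc]; apply: hn; exists (c `^ r^-1) => x.
by rewrite -(hc x) -powRrM divff// powRr1.
Qed.

Lemma moment_gt1 r s h : (forall x, 0 <= h x) -> ~ (exists c, forall x, h x = c) ->
  0 < r < s -> 1 <= moment r h -> 1 < moment s h.
Proof.
move=> h0 hn rs mr; have /andP[r0 r_s] := rs.
apply: le_lt_trans (moment_lt h0 hn rs).
rewrite -[leLHS](powRr0 (moment r h)); apply: ler_powR => //.
by rewrite ltW// divr_gt0// (lt_trans r0).
Qed.

Lemma moment_inj r s h : (forall x, 0 <= h x) -> ~ (exists c, forall x, h x = c) ->
  0 < r -> 0 < s -> moment r h = 1 -> moment s h = 1 -> r = s.
Proof.
move=> h0 hn r0 s0 mr ms; case: (ltgtP r s) => // rs; exfalso.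
  by have := @moment_gt1 r s h h0 hn; rewrite mr ms lexx ltxx r0 rs => /(_ isT isT).
by have := @moment_gt1 s r h h0 hn; rewrite mr ms lexx ltxx s0 rs => /(_ isT isT).
Qed.

Lemma moment_cvg {J : Type} (F : set_system J) {FF : Filter F} (v : J -> T -> R)
    (q : J -> R) h r :
  0 < r -> (forall x, 0 <= h x) -> (\forall j \near F, forall x, 0 <= v j x) ->
  (forall x, v j x @[j --> F] --> h x) -> q j @[j --> F] --> r ->
  moment (q j) (v j) @[j --> F] --> moment r h.
Proof.
move=> r0 h0 v0 vh qr; apply: cvg_sum_seq => x; apply: cvgMl_tmp.
by apply: cvg_powR => //; apply: filterS v0.
Qed.

Definition log_moment r h : R := expect w (fun x => h x `^ r * ln (h x)).

Lemma is_derive_moment_exponent r h : 0 < r -> (forall x, 0 <= h x) ->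
  is_derive r (1 : R) (fun q => moment q h) (log_moment r h).
Proof.
move=> r0 h0; apply: is_derive_sum_seq => x; apply: is_derive_scale.
exact: is_derive_powR_exponent.
Qed.

Lemma log_moment_cvg {J : Type} (F : set_system J) {FF : Filter F} (v : J -> T -> R)
    (q : J -> R) h r :
  0 < r -> (forall x, 0 <= h x) -> (\forall j \near F, forall x, 0 <= v j x) ->
  (forall x, v j x @[j --> F] --> h x) -> q j @[j --> F] --> r ->
  log_moment (q j) (v j) @[j --> F] --> log_moment r h.
Proof.
move=> r0 h0 v0 vh qr; apply: cvg_sum_seq => x; apply: cvgMl_tmp.
by apply: cvg_powR_ln => //; apply: filterS v0.
Qed.

Lemma xlnx_gt (v : R) : 0 <= v -> v != 1 -> v - 1 < v * ln v.
Proof.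
rewrite le_eqVlt => /predU1P[<- _|v0 v1]; first by rewrite mul0r; lra.
have : 1 + (- ln v) < expR (- ln v).
  by apply: expR_gt1Dx; rewrite oppr_eq0 ln_eq0.
rewrite expRN lnK ?posrE// -(ltr_pM2l v0) divff ?gt_eqF// => h.
by rewrite -subr_gt0 (_ : _ - _ = 1 - v * (1 + - ln v)) ?subr_gt0//; ring.
Qed.

(** Up to the factor [r] this is the entropy of [h ^ r], whose mean is 1; it is
    positive by v ln v > v - 1 at the values v <> 1 of [h ^ r]. *)
Lemma log_moment_gt0 r h : 0 < r -> (forall x, 0 <= h x) ->
  ~ (exists c, forall x, h x = c) -> moment r h = 1 -> 0 < log_moment r h.
Proof.
move=> r0 h0 hn hr.
have [z hz] := nonconst_neq hn 1.
have hz1 : h z `^ r != 1.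
  by rewrite powR_eq1 !negb_or hz -leNgt h0 gt_eqF.
suff : 0 < r * log_moment r h by rewrite pmulr_rgt0.
have -> : r * log_moment r h = \sum_x w x * (h x `^ r * ln (h x `^ r)).
  rewrite mulr_sumr; apply: eq_bigr => x _; rewrite ln_powR; ring.
have e0 : \sum_x w x * (h x `^ r - 1) = 0.
  under eq_bigr do rewrite mulrBr mulr1.
  by rewrite sumrB w_sum -/(expect w _) -/(moment r h) hr subrr.
rewrite -[ltLHS]e0; apply: (@ltr_sum_point _ _ z) => [x|]; last by rewrite ltr_pM2l// xlnx_gt// powR_ge0.
rewrite ler_pM2l//; have [->|n1] := eqVneq (h x `^ r) 1.
  by rewrite ln1 subrr mulr0.
by rewrite ltW// xlnx_gt// powR_ge0.
Qed.

End Moments.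

Lemma MVT_between {R : realType} (f df : R -> R) (s t : R) :
  (forall x, Num.min s t < x < Num.max s t -> is_derive x (1 : R) f (df x)) ->
  {within `[Num.min s t, Num.max s t], continuous f} ->
  exists xi, [/\ Num.min s t <= xi, `|xi - t| <= `|s - t| &
    f s - f t = df xi * (s - t)].
Proof.
move=> fd fc; have [xi] : exists2 xi, xi \in `[Num.min s t, Num.max s t] &
    f (Num.max s t) - f (Num.min s t) = df xi * (Num.max s t - Num.min s t).
  by apply: MVT_segment => //; rewrite ge_min le_max lexx.
rewrite in_itv/= => /andP[xi1 xi2] fE; exists xi; split => //.
  move: xi1 xi2; have [st|ts] := leP s t => xi1 xi2.
    by rewrite !ler0_norm; lra.
  by rewrite !ger0_norm; lra.
move: fE; have [st|ts] := leP s t => fE //.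
by rewrite -[LHS]opprB fE -[in RHS]opprB mulrN.
Qed.

Section Flow.
Context {R : realType} {T : finType} (w : T -> R) (u : R -> T -> R) (G : T -> T -> R).
Context (p0 t1 : R).
Implicit Types (s t q r : R).
Hypotheses (w_gt0 : forall x, 0 < w x) (w_sum : \sum_x w x = 1).
Hypothesis u_ge0 : forall t, 0 <= t -> forall x, 0 <= u t x.
Hypothesis u_gt0 : forall t, 0 < t -> forall x, 0 < u t x.
Hypothesis u_nonconst : forall t, 0 <= t -> ~ exists c, forall x, u t x = c.
Hypothesis u_derive : forall t x, is_derive t (1 : R) (u ^~ x) (\sum_y G x y * u t y).
Hypothesis moment_decreasing : forall s t q, 0 <= s < t -> 1 < q ->
  moment w q (u t) < moment w q (u s).
Hypotheses (p0_gt1 : 1 < p0) (moment_init : moment w p0 (u 0) = 1).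
Hypotheses (t1_ge0 : 0 <= t1) (u_small : forall x, u t1 x < 1).

Let N t q : R := moment w q (u t).

Lemma flow_cvg {J : Type} (F : set_system J) {FF : Filter F} (a : J -> R) t (x : T) :
  a j @[j --> F] --> t -> u (a j) x @[j --> F] --> u t x.
Proof. by move=> ?; apply: (continuous_cvg FF (is_derive_continuous (u_derive t x))). Qed.

Lemma flow_moment_cvg {J : Type} (F : set_system J) {FF : Filter F} (a q : J -> R) t r :
  0 <= t -> 0 < r -> (\forall j \near F, 0 <= a j) ->
  a j @[j --> F] --> t -> q j @[j --> F] --> r ->
  N (a j) (q j) @[j --> F] --> N t r.
Proof.
move=> t0 r0 a0 at_ qr; apply: moment_cvg => //; first exact: u_ge0.
  by apply: filterS a0 => j; exact: u_ge0.
by move=> x; exact: flow_cvg.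
Qed.

Let N_within a b q : 0 <= a -> 0 < q -> {within `[a, b], continuous (N ^~ q)}.
Proof.
move=> a0 q0; apply/subspace_continuousP => t /=; rewrite in_itv/= => /andP[a_t tb].
apply: flow_moment_cvg => //.
- exact: le_trans a_t.
- near=> s; have : `[a, b]%classic s by near: s; exact: near_within_mem.
  by rewrite /= in_itv/= => /andP[+ _]; exact: le_trans.
- exact: cvg_within_filter cvg_id.
- exact: cvg_cst.
Unshelve. all: by end_near.
Qed.

(** The moment of exponent [q] starts at 1 or above, and is at most 1 once [u] is
    below 1. *)
Lemma hitting_time q : p0 <= q -> exists2 t, 0 <= t <= t1 & N t q = 1.
Proof.
have p01 := p0_gt1; move=> p0q; have q0 : 0 < q by lra.
have N0 : 1 <= N 0 q.
  move: p0q; rewrite le_eqVlt => /predU1P[<-|p0q]; first by rewrite /N moment_init.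
  apply: ltW; apply: (@moment_gt1 _ _ _ _ _ p0) => //.
  - exact: u_ge0.
  - exact: u_nonconst.
  - by rewrite p0q andbT; lra.
  - by rewrite moment_init.
have N1 : N t1 q <= 1.
  by apply: moment_le1 => // x; rewrite u_ge0//= ltW.
have [|t] := IVT (v := 1) t1_ge0 (N_within (b := t1) (lexx 0) q0).
  by rewrite ge_min le_max N0 N1 orbT.
by rewrite in_itv/=; exists t.
Qed.

(** The horizon is the supremum of the hitting times of all exponents.  Before
    it, some later time is hit by an exponent q, so N(t, q) > 1 >= N(t, p0) and
    an exponent in between solves the equation at [t]; the horizon itself is
    not hit because larger exponents are hit strictly later. *)
Lemma exponent_exists : exists (t0 : R) (p : R -> R),
  [/\ 0 < t0, forall t, 0 <= t < t0 -> p0 <= p t /\ N t (p t) = 1 &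
      forall q, p0 <= q -> exists2 t, 0 <= t < t0 & p t = q].
Proof.
have p01 := p0_gt1.
pose S := [set t | 0 <= t /\ exists2 q, p0 <= q & N t q = 1].
have S0 : S 0 by split => //; exists p0.
have N_gt1 t q r : 0 <= t -> 0 < q < r -> 1 <= N t q -> 1 < N t r.
  by move=> t0; apply: moment_gt1 => //; [exact: u_ge0|exact: u_nonconst].
have N_dec s t q : 0 <= s < t -> p0 <= q -> N t q < N s q.
  by move=> st p0q; apply: moment_decreasing => //; lra.
have S_ub : ubound S t1.
  move=> t [t0 [q p0q Nt]]; rewrite leNgt; apply/negP => t1t.
  have : N t q < N t1 q by apply: N_dec => //; rewrite t1_ge0.
  rewrite Nt ltNge => /negP; apply.
  by apply: moment_le1 => // [|x]; [lra|rewrite u_ge0//= ltW].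
have S_up t q : 0 <= t -> p0 <= q -> N t q = 1 -> exists2 s, t < s & S s.
  move=> t0 p0q Nt; have [|s /andP[s0 _] Ns] := @hitting_time (q + 1); first by lra.
  exists s; last by split => //; exists (q + 1) => //; lra.
  rewrite ltNge; apply/negP => st.
  have h1 : 1 < N t (q + 1) by apply: (N_gt1 t q) => //; [lra|rewrite Nt].
  have : N t (q + 1) <= N s (q + 1).
    move: st; rewrite le_eqVlt => /predU1P[->//|st].
    by apply/ltW/N_dec; [rewrite s0|lra].
  by rewrite Ns leNgt h1.
have S_has : has_sup S by split; [exists 0|exists t1].
have S_lt t : S t -> t < sup S.
  move=> [t0 [q p0q Nt]]; have [s ts Ss] := S_up t q t0 p0q Nt.
  by apply: lt_le_trans ts _; apply: sup_upper_bound.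
have S_itv t : 0 <= t < sup S -> exists q, p0 <= q /\ N t q = 1.
  move=> /andP[t0 tS]; have [|s [s0 [q p0q Ns]] ts] := sup_gt _ tS; first by exists 0.
  have Nq : 1 <= N t q by rewrite -Ns; apply/ltW/N_dec => //; rewrite t0.
  have Np0 : N t p0 <= 1.
    rewrite -moment_init; move: t0; rewrite le_eqVlt => /predU1P[<-//|t0].
    by apply/ltW/N_dec => //; rewrite lexx.
  have Ncont : {within `[p0, q], continuous (N t)}.
    apply/subspace_continuousP => r /=; rewrite in_itv/= => /andP[p0r _].
    apply: flow_moment_cvg => //.
    - lra.
    - by near=> j.
    - exact: cvg_cst.
    - exact: cvg_within_filter cvg_id.
  have [|r] := IVT (v := 1) p0q Ncont; first by rewrite ge_min le_max Np0 Nq orbT.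
  by rewrite in_itv/= => /andP[p0r _] Nr; exists r.
have [|p hp] := @choice _ _ (fun t q => 0 <= t < sup S -> p0 <= q /\ N t q = 1).
  by move=> t; have [/S_itv[q]|] := boolP (0 <= t < sup S); [exists q|exists p0].
exists (sup S), p; split => //; first exact: S_lt.
move=> q p0q; have [t /andP[t0 _] Nt] := hitting_time p0q.
have tS : 0 <= t < sup S by rewrite t0/=; apply: S_lt; split=> //; exists q.
exists t => //; have [p0pt Npt] := hp t tS.
apply: (@moment_inj _ _ w w_gt0 w_sum _ _ (u t)) => //.
- exact: u_ge0.
- exact: u_nonconst.
- lra.
- lra.
Unshelve. all: by end_near.
Qed.

Section Exponent.
Context (t0 : R) (p : R -> R).
Hypothesis p_spec : forall t, 0 <= t < t0 -> p0 <= p t /\ N t (p t) = 1.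
Hypothesis p_surj : forall q, p0 <= q -> exists2 t, 0 <= t < t0 & p t = q.

Lemma exponent_increasing s t : 0 <= s < t0 -> 0 <= t < t0 -> s < t -> p s < p t.
Proof.
have p01 := p0_gt1.
move=> sI tI st; have [p0s Ns] := p_spec sI; have [p0t Nt] := p_spec tI.
have /andP[s0 _] := sI; have /andP[tge0 _] := tI.
have Nts : N t (p s) < 1.
  by rewrite -Ns; apply: moment_decreasing; [rewrite s0|lra].
rewrite ltNge; apply/negP; rewrite le_eqVlt => /predU1P[ptps|ptps].
  by move: Nts; rewrite -ptps Nt ltxx.
have : 1 < N t (p s).
  apply: (@moment_gt1 _ _ _ _ _ (p t)) => //.
  - exact: u_ge0.
  - exact: u_nonconst.
  - by rewrite ptps andbT; lra.
  - by rewrite -/(N t (p t)) Nt.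
by rewrite ltNge (ltW Nts).
Qed.

Let I : set R := `[0, t0[%classic.

Let IP t : I t = (0 <= t < t0).
Proof. by rewrite /I/= in_itv. Qed.

(** A strictly increasing map onto an interval cannot jump: nearby values above
    and below [p t] are attained, at times that confine [s] to a neighbourhood. *)
Lemma exponent_continuous t : 0 <= t < t0 -> p s @[s --> within I (nbhs t)] --> p t.
Proof.
move=> tI; have [p0t Nt] := p_spec tI.
have p_mono s r : 0 <= s < t0 -> 0 <= r < t0 -> p s < p r -> s < r.
  move=> sI rI; rewrite !ltNge; apply: contra.
  by rewrite le_eqVlt => /predU1P[->//|] /(exponent_increasing rI sI)/ltW.
apply/cvgrPdist_lt => e e0.
have [b bI pb] : exists2 b, 0 <= b < t0 & p b = p t + e by apply: p_surj; lra.
have tb : t < b by apply: p_mono => //; lra.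
have up : \forall s \near within I (nbhs t), p s < p t + e.
  near=> s; rewrite -pb; apply: exponent_increasing => //.
    by rewrite -IP; near: s; exact: near_within_mem.
  by near: s; apply: cvg_within; exact: lt_nbhsl.
have lo : \forall s \near within I (nbhs t), p t - e < p s.
  have [h|h] := leP p0 (p t - e); last first.
    near=> s; have sI : 0 <= s < t0 by rewrite -IP; near: s; exact: near_within_mem.
    by have [p0s _] := p_spec sI; exact: lt_le_trans h p0s.
  have [a aI pa] := p_surj h.
  have a_t : a < t by apply: p_mono => //; lra.
  near=> s; rewrite -pa; apply: exponent_increasing => //.
    by rewrite -IP; near: s; exact: near_within_mem.
  by near: s; apply: cvg_within; exact: lt_nbhsr.
near=> s.
have psl : p s < p t + e by near: s.
have psu : p t - e < p s by near: s.
by rewrite ltr_norml; apply/andP; split; lra.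
Unshelve. all: by end_near.
Qed.


Definition moment_rate t q : R :=
  q * expect w (fun x => u t x `^ (q - 1) * \sum_y G x y * u t y).

Lemma is_derive_moment_time t q : 0 < t ->
  is_derive t (1 : R) (N ^~ q) (moment_rate t q).
Proof.
move=> tgt0; rewrite /moment_rate /expect mulr_sumr.
apply: is_derive_sum_seq => x; rewrite mulrCA; apply: is_derive_scale.
rewrite mulrA; apply: (is_derive1_comp (f := fun a => a `^ q) (g := u ^~ x)).
by apply: is_derive1_powR; exact: u_gt0.
Qed.

Lemma moment_rate_cvg {J : Type} (F : set_system J) {FF : Filter F} (a q : J -> R) t r :
  0 <= t -> 1 < r -> (\forall j \near F, 0 <= a j) ->
  a j @[j --> F] --> t -> q j @[j --> F] --> r ->
  moment_rate (a j) (q j) @[j --> F] --> moment_rate t r.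
Proof.
move=> t_ge0 r1 a0 at_ qr; apply: cvgM => //; apply: cvg_sum_seq => x.
apply: cvgMl_tmp; apply: cvgM.
  apply: cvg_powR; [lra|exact: u_ge0| |exact: flow_cvg|].
    by apply: filterS a0 => j /u_ge0.
  by apply: cvgB => //; exact: cvg_cst.
by apply: cvg_sum_seq => y; apply: cvgMl_tmp; exact: flow_cvg.
Qed.

Lemma flow_log_moment_cvg {J : Type} (F : set_system J) {FF : Filter F} (a q : J -> R) t r :
  0 <= t -> 0 < r -> (\forall j \near F, 0 <= a j) ->
  a j @[j --> F] --> t -> q j @[j --> F] --> r ->
  log_moment w (q j) (u (a j)) @[j --> F] --> log_moment w r (u t).
Proof.
move=> t_ge0 r0 a0 at_ qr; apply: log_moment_cvg => //; first exact: u_ge0.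
  by apply: filterS a0 => j; exact: u_ge0.
by move=> x; exact: flow_cvg.
Qed.

Lemma moment_MVT_time s t q : 0 <= s -> 0 <= t -> 0 < q ->
  exists xi, [/\ 0 <= xi, `|xi - t| <= `|s - t| &
    N s q - N t q = moment_rate xi q * (s - t)].
Proof.
move=> s0 t_ge0 q0; have m0 : 0 <= Num.min s t by rewrite le_min s0.
have [|xi [xi0 xi1 xi2]] := @MVT_between _ (N ^~ q) (moment_rate ^~ q) s t _ (N_within m0 q0).
  by move=> x /andP[mx _]; apply: is_derive_moment_time; exact: le_lt_trans mx.
by exists xi; split => //; exact: le_trans xi0.
Qed.

Lemma moment_MVT_exponent t q r : 0 <= t -> 0 < q -> 0 < r ->
  exists eta, `|eta - r| <= `|q - r| /\
    N t q - N t r = log_moment w eta (u t) * (q - r).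
Proof.
move=> t_ge0 q0 r0; have m0 : 0 < Num.min q r by rewrite lt_min q0.
have hd (x : R) : 0 < x -> is_derive x (1 : R) (N t) (log_moment w x (u t)).
  by move=> x0; apply: is_derive_moment_exponent => //; exact: u_ge0.
have [| |eta [_ e1 e2]] := @MVT_between _ (N t) (fun x => log_moment w x (u t)) q r.
- by move=> x /andP[mx _]; apply: hd; exact: lt_trans mx.
- apply: continuous_in_subspaceT => x; rewrite inE/= in_itv/= => /andP[mx _].
  by apply: is_derive_continuous; apply: hd; exact: lt_le_trans mx.
- by exists eta.
Qed.

Definition exponent_velocity t : R :=
  - moment_rate t (p t) / log_moment w (p t) (u t).

Lemma exponent_log_moment_gt0 t : 0 <= t < t0 -> 0 < log_moment w (p t) (u t).
Proof.
have p01 := p0_gt1; move=> tI; have [p0t Nt] := p_spec tI; have /andP[t_ge0 _] := tI.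
by apply: log_moment_gt0 => //; [lra|exact: u_ge0|exact: u_nonconst].
Qed.

(** Implicit differentiation of N (t, p t) = 1, which the mean value theorem in
    each variable makes valid at [t = 0] as well, where [u 0] may vanish. *)
Lemma exponent_slope t : 0 <= t < t0 -> has_slope I p t (exponent_velocity t).
Proof.
have p01 := p0_gt1; move=> tI; have [p0t Nt] := p_spec tI; have /andP[t_ge0 _] := tI.
have pt0 : 0 < p t by lra.
have [|xi hxi] := @choice R R (fun s xi => 0 <= s < t0 -> [/\ 0 <= xi,
    `|xi - t| <= `|s - t| & N s (p s) - N t (p s) = moment_rate xi (p s) * (s - t)]).
  move=> s; have [sI|] := boolP (0 <= s < t0); last by exists 0.
  have [p0s _] := p_spec sI; have /andP[s0 _] := sI.
  by have [|xi] := @moment_MVT_time s t (p s) s0 t_ge0; [lra|exists xi].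
have [|eta heta] := @choice R R (fun s eta => 0 <= s < t0 ->
    `|eta - p t| <= `|p s - p t| /\
    N t (p s) - N t (p t) = log_moment w eta (u t) * (p s - p t)).
  move=> s; have [sI|] := boolP (0 <= s < t0); last by exists 0.
  have [p0s _] := p_spec sI.
  by have [| |eta] := @moment_MVT_exponent t (p s) (p t) t_ge0; [lra|lra|exists eta].
have mem : \forall s \near within I (nbhs t), 0 <= s < t0.
  by apply: filterS (near_within_mem I t) => s; rewrite IP.
have ct : s @[s --> within I (nbhs t)] --> t by exact: cvg_within_filter cvg_id.
have cp := exponent_continuous tI.
have cxi : xi s @[s --> within I (nbhs t)] --> t.
  apply/cvgrPdist_lt => e e0; have /cvgrPdist_lt/(_ e e0) hn := ct; near=> s.
  have sI : 0 <= s < t0 by near: s.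
  have [_ h _] := hxi s sI; rewrite distrC; apply: le_lt_trans h _; rewrite distrC.
  by near: s; exact: hn.
have ceta : eta s @[s --> within I (nbhs t)] --> p t.
  apply/cvgrPdist_lt => e e0; have /cvgrPdist_lt/(_ e e0) hn := cp; near=> s.
  have sI : 0 <= s < t0 by near: s.
  have [h _] := heta s sI; rewrite distrC; apply: le_lt_trans h _; rewrite distrC.
  by near: s; exact: hn.
have cD1 : moment_rate (xi s) (p s) @[s --> within I (nbhs t)] --> moment_rate t (p t).
  apply: moment_rate_cvg => //; first lra.
  by apply: filterS mem => s /hxi[].
have cD2 : log_moment w (eta s) (u t) @[s --> within I (nbhs t)] --> log_moment w (p t) (u t).
  by apply: flow_log_moment_cvg => //; [near=> s|exact: cvg_cst].
have D2gt0 := exponent_log_moment_gt0 tI.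
(* Off t the slope of p is - N_t(xi s, p s) / N_q(t, eta s), as soon as the
   denominator, which converges to a positive number, is nonzero. *)
exists (fun s => if s == t then exponent_velocity t else (p s - p t) / (s - t)).
  move=> s _; case: eqVneq => [->|st]; first by rewrite !subrr mulr0.
  by rewrite divfK// subr_eq0.
apply: (@cvg_trans _ (- moment_rate (xi s) (p s) / log_moment w (eta s) (u t)
    @[s --> within I (nbhs t)])); last first.
  apply: cvgM; first exact: cvgN.
  by apply: cvgV => //; rewrite gt_eqF.
apply: near_eq_cvg; near=> s.
have sI : 0 <= s < t0 by near: s.
have D2s : 0 < log_moment w (eta s) (u t) by near: s; exact: cvgr_gt cD2 _ D2gt0.
have [_ xis E1] := hxi s sI; have [etas E2] := heta s sI.
have [p0s Ns] := p_spec sI.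
have [st|st] := eqVneq s t.
  move: xis etas; rewrite st subrr normr0 normr_le0 subr_eq0 => /eqP->.
  by rewrite subrr normr0 normr_le0 subr_eq0 => /eqP->.
have stn0 : s - t != 0 by rewrite subr_eq0.
have e : moment_rate (xi s) (p s) * (s - t) = - (log_moment w (eta s) (u t) * (p s - p t)).
  by rewrite -E1 -E2 Ns Nt opprB.
have D2n0 : log_moment w (eta s) (u t) != 0 by rewrite gt_eqF.
apply/eqP; rewrite eqr_div// mulNr e opprK mulrC; exact: eqxx.
Unshelve. all: by end_near.
Qed.

Lemma exponent_velocity_continuous : Ck_on 0 I exponent_velocity.
Proof.
have p01 := p0_gt1; apply/C0P => t; rewrite IP => tI.
have [p0t Nt] := p_spec tI; have /andP[t_ge0 _] := tI.
have mem : \forall s \near within I (nbhs t), 0 <= s.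
  by apply: filterS (near_within_mem I t) => s; rewrite IP => /andP[].
have ct : s @[s --> within I (nbhs t)] --> t by exact: cvg_within_filter cvg_id.
have cp := exponent_continuous tI.
apply: cvgM; first by apply: cvgN; apply: moment_rate_cvg => //; lra.
apply: cvgV; first by rewrite gt_eqF// exponent_log_moment_gt0.
by apply: flow_log_moment_cvg => //; lra.
Qed.

(** While [u] stays positive its powers are exp (p ln u), so the derivative of
    [p] is built from [p] and [u] by smooth operations and each order of
    smoothness gives the next. *)
Lemma exponent_smooth (J : set R) : J `<=` I ->
  (forall t, J t -> ProperFilter (within J t^')) ->
  (forall t x, J t -> 0 < u t x) -> smooth_on J p.
Proof.
move=> JI J_limit Jpos.
have uC k x : Ck_on k J (u ^~ x).
  elim: k x => [|k IH] x.
    by apply: Ck_cont => t Jt; eexists; apply: has_slope_derive.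
  apply/CkSP => //; exists (fun t => \sum_y G x y * u t y).
    by move=> t _; exact: has_slope_derive.
  by apply: Ck_sum => // y; apply: CkM => //; exact: Ck_cst.
elim=> [|k IH].
  by apply: Ck_cont => t /JI; rewrite IP => tI; eexists; apply: has_slope_sub JI _; exact: exponent_slope.
apply/CkSP => //; exists exponent_velocity.
  by move=> t /JI; rewrite IP => tI; apply: has_slope_sub JI _; exact: exponent_slope.
have duC x : Ck_on k J (fun t => \sum_y G x y * u t y).
  by apply: Ck_sum => // y; apply: CkM => //; exact: Ck_cst.
have lnC x : Ck_on k J (fun t => ln (u t x)).
  by apply: Ck_ln => // t; exact: Jpos.
pose rate t := p t * \sum_x w x * (expR ((p t + -1) * ln (u t x)) * \sum_y G x y * u t y).
pose logm t := \sum_x w x * (expR (p t * ln (u t x)) * ln (u t x)).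
have rateE t : J t -> moment_rate t (p t) = rate t.
  move=> Jt; congr (_ * _); apply: eq_bigr => x _.
  by rewrite /powR gt_eqF// Jpos.
have logE t : J t -> log_moment w (p t) (u t) = logm t.
  by move=> Jt; apply: eq_bigr => x _; rewrite /powR gt_eqF// Jpos.
apply: (@Ck_ext _ J J_limit k (fun t => -1 * rate t * (logm t)^-1)) => //.
  by move=> t Jt; rewrite mulN1r -rateE// -logE.
apply: CkM => //.
  apply: CkM => //; first exact: Ck_cst.
  apply: CkM => //; apply: Ck_sum => // x; apply: CkM => //; first exact: Ck_cst.
  apply: CkM => //; apply: Ck_expR => //; apply: CkM => //.
  by apply: CkD => //; exact: Ck_cst.
apply: Ck_inv => // [t Jt|].
  by rewrite -logE// gt_eqF// exponent_log_moment_gt0// -IP; exact: JI.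
apply: Ck_sum => // x; apply: CkM => //; first exact: Ck_cst.
by apply: CkM => //; apply: Ck_expR => //; exact: CkM.
Qed.

End Exponent.
End Flow.

(** * The heat kernel of a generator *)

Section HeatKernel.
Context {R : realType} {X : finType} (L : X -> X -> R).
Implicit Types (s t : R) (x y z : X) (k : nat).

Let M : R := \sum_x \sum_y `|L x y|.

Let M_ge0 : 0 <= M.
Proof. by apply: sumr_ge0 => x _; exact: sumr_ge0. Qed.

Lemma genpow_bound k x y : `|genpow L k x y| <= M ^+ k.
Proof.
elim: k x => [|k IH] x /=; first by rewrite expr0; case: eqVneq; rewrite ?normr1 ?normr0.
apply: le_trans (ler_norm_sum _ _ _) _.
apply: (@le_trans _ _ (\sum_z `|L x z| * M ^+ k)).
  by apply: ler_sum => z _; rewrite normrM ler_wpM2l.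
rewrite -mulr_suml exprS ler_wpM2r ?exprn_ge0//.
by rewrite /M [leRHS](bigD1 x)//= lerDl sumr_ge0// => z _; exact: sumr_ge0.
Qed.

Lemma genpowSr k x y : genpow L k.+1 x y = \sum_z genpow L k x z * L z y.
Proof.
elim: k x => [|k IH] x.
  rewrite /= (bigD1 y)//= eqxx mulr1 big1 ?addr0; last first.
    by move=> z /negbTE->; rewrite mulr0.
  rewrite (bigD1 x)//= eqxx mul1r big1 ?addr0// => z.
  by rewrite eq_sym => /negbTE->; rewrite mul0r.
change (\sum_z L x z * genpow L k.+1 z y = \sum_z genpow L k.+1 x z * L z y).
under eq_bigr do rewrite IH mulr_sumr.
rewrite exchange_big/=; apply: eq_bigr => z _.
by rewrite /= mulr_suml; apply: eq_bigr => v _; rewrite mulrA.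
Qed.

Lemma cvg_pseries_exponential_type (a : nat -> R) (C t : R) :
  (forall k, `|a k| <= C * (M ^+ k / k`!%:R)) -> cvgn (pseries a t).
Proof.
move=> aC; apply: normed_cvg.
have C0 : 0 <= C by have := aC 0; rewrite expr0 fact0 divr1 mulr1; exact: le_trans.
apply: (@series_le_cvg _ _ (fun k => C * exp_coeff (M * `|t|) k)) => [k|k|k|].
- exact: normr_ge0.
- by rewrite mulr_ge0// /exp_coeff/= divr_ge0// exprn_ge0// mulr_ge0.
- rewrite /exp_coeff/= normrM normrX exprMn.
  apply: le_trans (ler_wpM2r _ (aC k)) _; first by rewrite exprn_ge0.
  by rewrite le_eqVlt; apply/orP; left; apply/eqP; rewrite -!mulrA; congr (_ * _); rewrite mulrCA mulrC -!mulrA.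
- by apply: is_cvg_seriesZ; exact: is_cvg_series_exp_coeff.
Qed.

(** Coefficients of the j-th derivative of the power series of exp (t L). *)
Let coef j x y k : R := genpow L (k + j) x y / k`!%:R.

Let cvg_coef j x y t : cvgn (pseries (coef j x y) t).
Proof.
apply: (@cvg_pseries_exponential_type _ (M ^+ j)) => k.
rewrite /coef normrM mulrA -exprD addnC normfV [`|_%:R|]ger0_norm//.
by rewrite ler_wpM2r ?invr_ge0// genpow_bound.
Qed.

Let diffs_coef j x y : pseries_diffs (coef j x y) = coef j.+1 x y.
Proof.
apply/funext => k; rewrite /pseries_diffs /coef addSnnS factS natrM invfM.
by rewrite mulrCA mulVKf// addnS.
Qed.

Let heatE t x y : heat L t x y = limn (pseries (coef 0 x y) t).
Proof.
rewrite /heat /pseries; congr (limn (series _)); apply/funext => k.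
by rewrite /exp_coeff/= /coef addn0 mulrC [RHS]mulrAC mulrA.
Qed.

Let heat_cvg t x y : pseries (coef 0 x y) t n @[n --> \oo] --> heat L t x y.
Proof. by rewrite heatE; exact: cvg_coef. Qed.

Let coef1_cvg_left t x y :
  pseries (coef 1 x y) t n @[n --> \oo] --> \sum_z L x z * heat L t z y.
Proof.
have -> : pseries (coef 1 x y) t = fun n => \sum_z L x z * pseries (coef 0 z y) t n.
  apply/funext => n; rewrite /pseries /series/=.
  under [RHS]eq_bigr do rewrite mulr_sumr.
  rewrite exchange_big/=; apply: eq_bigr => k _.
  rewrite /coef addn1 addn0/= mulr_suml mulr_suml; apply: eq_bigr => z _.
  by rewrite !mulrA.
by apply: cvg_sum_seq => z; apply: cvgMl_tmp; exact: heat_cvg.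
Qed.

Let coef1_cvg_right t x y :
  pseries (coef 1 x y) t n @[n --> \oo] --> \sum_z heat L t x z * L z y.
Proof.
have -> : pseries (coef 1 x y) t = fun n => \sum_z pseries (coef 0 x z) t n * L z y.
  apply/funext => n; rewrite /pseries /series/=.
  under [RHS]eq_bigr do rewrite mulr_suml.
  rewrite exchange_big/=; apply: eq_bigr => k _.
  rewrite /coef addn1 genpowSr !mulr_suml; apply: eq_bigr => z _.
  by rewrite addn0 -!mulrA; congr (_ * _); rewrite mulrC -mulrA mulrCA.
by apply: cvg_sum_seq => z; apply: cvgMr_tmp; exact: heat_cvg.
Qed.

Lemma heat_derive t x y :
  is_derive t (1 : R) (fun s => heat L s x y) (\sum_z L x z * heat L t z y).
Proof.
have -> : (fun s => heat L s x y) = (fun s => limn (pseries (coef 0 x y) s)).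
  by apply/funext => s; exact: heatE.
have <- : limn (pseries (pseries_diffs (coef 0 x y)) t) = \sum_z L x z * heat L t z y.
  by rewrite diffs_coef; apply: cvg_lim => //; exact: coef1_cvg_left.
apply: (@pseries_snd_diffs _ _ (`|t| + 1)).
- exact: cvg_coef.
- by rewrite diffs_coef; exact: cvg_coef.
- by rewrite !diffs_coef; exact: cvg_coef.
- by rewrite [ltRHS]ger0_norm ?addr_ge0// ltrDl.
Qed.

(** Both sides are the sum of the series of L^(k+1) t^k / k!. *)
Lemma heat_commute t x y : \sum_z L x z * heat L t z y = \sum_z heat L t x z * L z y.
Proof. exact: cvg_unique (@coef1_cvg_left t x y) (@coef1_cvg_right t x y). Qed.

Lemma heat0 x y : heat L 0 x y = (x == y)%:R.
Proof.
rewrite heatE; apply: cvg_lim => //.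
apply: (@cvg_trans _ ((fun=> (x == y)%:R : R) @ \oo)); last exact: cvg_cst.
apply: near_eq_cvg; exists 1 => // -[//|n] _ /=.
rewrite /pseries /series/= big_nat_recl// big1 ?addr0; last first.
  by move=> k _; rewrite expr0n/= mulr0.
by rewrite /coef/= expr0 mulr1 fact0 divr1.
Qed.

Lemma sum_delta (f : X -> R) x : \sum_z (x == z)%:R * f z = f x.
Proof.
rewrite (bigD1 x)//= eqxx mul1r big1 ?addr0// => z.
by rewrite eq_sym => /negbTE->; rewrite mul0r.
Qed.

(** Uniqueness for u' = L u: the function exp ((t - s) L) (u s) of [s] is constant. *)
Lemma heat_unique (u : R -> X -> R) :
  (forall t x, is_derive t (1 : R) (u ^~ x) (\sum_z L x z * u t z)) ->
  forall t x, u t x = \sum_z heat L t x z * u 0 z.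
Proof.
move=> uL t x; pose phi s := \sum_z heat L (t - s) x z * u s z.
have dphi s : is_derive s (1 : R) phi 0.
  have dh z : is_derive s (1 : R) (fun s => heat L (t - s) x z)
      ((\sum_v heat L (t - s) x v * L v z) * -1).
    rewrite -heat_commute.
    apply: (is_derive1_comp (f := fun r => heat L r x z) (g := fun s => t - s)).
      exact: heat_derive.
    exact: is_derive_eq (is_deriveB (is_derive_cst t s (1 : R)) (is_derive_id s (1 : R))) (sub0r _).
  have dz z : is_derive s (1 : R) (fun s => heat L (t - s) x z * u s z) _ :=
    is_deriveM (dh z) (uL s z).
  apply: (is_derive_eq (is_derive_sum_seq (index_enum X) dz)).
  rewrite big_split/=.
  have -> : \sum_z heat L (t - s) x z *: (\sum_y L z y * u s y) =
      \sum_y u s y * \sum_z heat L (t - s) x z * L z y.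
    under eq_bigr do rewrite /GRing.scale/= mulr_sumr.
    rewrite exchange_big/=; apply: eq_bigr => y _.
    by rewrite mulr_sumr; apply: eq_bigr => z _; ring.
  rewrite -big_split/= big1// => z _.
  by rewrite /GRing.scale/= mulrN1 mulrN subrr.
have := is_derive_0_is_cst t 0 dphi; rewrite /phi subrr subr0 => <-.
by under eq_bigr do rewrite heat0; rewrite sum_delta.
Qed.

Lemma heatD s t x y : heat L (s + t) x y = \sum_z heat L s x z * heat L t z y.
Proof.
rewrite -[in RHS](add0r t).
apply: (heat_unique (u := fun s z => heat L (s + t) z y)) => r z.
rewrite -[X in is_derive _ _ _ X]mulr1.
apply: (is_derive1_comp (f := fun r => heat L r z y) (g := fun s => s + t)).
  exact: heat_derive.
exact: is_derive_eq (is_deriveD (is_derive_id r (1 : R)) (is_derive_cst t r (1 : R))) (addr0 _).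
Qed.

Lemma heat_row_sum t x : (forall x, \sum_y L x y = 0) -> \sum_y heat L t x y = 1.
Proof.
move=> L0; have h s z : is_derive s (1 : R) (fun=> (1 : R)) (\sum_y L z y * 1).
  by under eq_bigr do rewrite mulr1; rewrite L0; exact: is_derive_cst.
by rewrite [RHS](heat_unique h t x); apply: eq_bigr => y _; rewrite mulr1.
Qed.

Lemma heat_gt0_of_genpow t x y k : (forall u v, 0 <= L u v) -> 0 < t ->
  0 < genpow L k x y -> 0 < heat L t x y.
Proof.
move=> L0 t0 kpos.
have gp j u v : 0 <= genpow L j u v.
  by elim: j u => [|j IH] u /=; [exact: ler0n|apply: sumr_ge0 => z _; rewrite mulr_ge0].
have cp j : 0 <= coef 0 x y j * t ^+ j.
  by rewrite mulr_ge0 ?exprn_ge0 ?(ltW t0)// divr_ge0.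
have nd : nondecreasing_seq (pseries (coef 0 x y) t).
  by apply/nondecreasing_seqP => n; rewrite /pseries /series/= big_nat_recr//= lerDl.
rewrite heatE; apply: lt_le_trans (nondecreasing_cvgn_le nd (cvg_coef (j := 0) (t := t)) k.+1).
rewrite /pseries /series/= big_nat_recr//= ltr_wpDl//.
  by apply: sumr_ge0 => j _; exact: cp.
by rewrite mulr_gt0 ?exprn_gt0// divr_gt0 ?addn0.
Qed.

Lemma genpow_connect x y : (forall u v, 0 <= L u v) ->
  connect (fun u v => 0 < L u v) x y -> exists k, 0 < genpow L k x y.
Proof.
move=> L0 /connectP[s]; elim: s x => [|z s IH] x /=.
  by move=> _ ->; exists 0%N => /=; rewrite eqxx.
move=> /andP[xz zs] ys; have [k kz] := IH z zs ys; exists k.+1 => /=.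
have gp j u v : 0 <= genpow L j u v.
  by elim: j u => [|j IHj] u /=; [exact: ler0n|apply: sumr_ge0 => v' _; rewrite mulr_ge0].
rewrite (bigD1 z)//= ltr_pwDl ?mulr_gt0//.
by apply: sumr_ge0 => v _; rewrite mulr_ge0.
Qed.

End HeatKernel.

Section Generator.
Context {R : realType} {X : finType} (L : X -> X -> R).
Hypotheses (hL : is_generator L) (hirr : irreducible L).

(** Adding a large multiple of the identity makes all entries nonnegative and
    only multiplies the exponential by a scalar, so irreducibility gives
    positivity term by term. *)
Lemma heat_gt0 t x y : 0 < t -> 0 < heat L t x y.
Proof.
move=> t0; have [Lpos L0] := hL.
pose c := \sum_x `|L x x|.
pose A x y := L x y + c * (x == y)%:R.
have A0 u v : 0 <= A u v.
  rewrite /A; have [->|uv] := eqVneq u v; last by rewrite mulr0 addr0 Lpos.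
  rewrite mulr1 /c (bigD1 v)//= addrA addr_ge0 ?sumr_ge0//.
  by rewrite -lerBlDl sub0r ler_normr lexx orbT.
have AL u v : 0 < L u v -> 0 < A u v.
  move=> Luv; rewrite ltr_pwDl// mulr_ge0// sumr_ge0//.
have [k kxy] : exists k, 0 < genpow A k x y.
  apply: genpow_connect => //; apply: connect_sub (hirr x y) => u v /AL.
  exact: connect1.
have Apos := heat_gt0_of_genpow A0 t0 kxy.
pose v s z := expR (- c * s) * heat A s z y.
have dv s z : is_derive s (1 : R) (v ^~ z) (\sum_z' L z z' * v s z').
  have de : is_derive s (1 : R) (fun s => expR (- c * s)) (expR (- c * s) * (- c)).
    apply: (is_derive1_comp (f := expR) (g := fun s => - c * s)).
    by have := is_derive_scale (- c) (is_derive_id s (1 : R)); rewrite mulr1.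
  have dp : is_derive s (1 : R) (fun s => expR (- c * s) * heat A s z y) _ :=
    is_deriveM de (heat_derive A s z y).
  apply: (is_derive_eq dp).
  rewrite /GRing.scale/=.
  under eq_bigr do rewrite mulrDl -mulrA.
  rewrite big_split/= -mulr_sumr.
  have -> : \sum_z' (z == z')%:R * heat A s z' y = heat A s z y by exact: sum_delta.
  rewrite mulrDr [X in _ + X]mulrC -addrA [X in _ + X](_ : _ = 0) ?addr0; last by ring.
  by rewrite mulr_sumr; apply: eq_bigr => z' _; rewrite /v mulrCA.
have := heat_unique dv t x; rewrite /v mulr0 expR0.
under eq_bigr do rewrite mul1r heat0 eq_sym mulrC.
by rewrite sum_delta => <-; rewrite mulr_gt0// expR_gt0.
Qed.

Section Stationary.
Context (mu : X -> R).
Hypotheses (hmu : is_prob mu) (hstat : stationary L mu).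

Lemma stationary_gt0 y : 0 < mu y.
Proof.
have [mu0 mu1] := hmu; rewrite -(hstat ler01 y).
have [x mux] : exists x, 0 < mu x.
  apply: contrapT => hn; have : \sum_x mu x = 0.
    apply: big1 => x _; apply/eqP; rewrite eq_le mu0 andbT leNgt.
    by apply/negP => h; apply: hn; exists x.
  by rewrite mu1 => /eqP; rewrite oner_eq0.
rewrite (bigD1 x)//= ltr_pwDl ?mulr_gt0 ?heat_gt0//.
by apply: sumr_ge0 => z _; rewrite mulr_ge0// ltW// heat_gt0.
Qed.

(** Differentiate the stationarity identity at time 1. *)
Lemma stationary_generator y : \sum_x mu x * L x y = 0.
Proof.
pose g t := \sum_x mu x * heat L t x y.
have dg : is_derive (1 : R) (1 : R) g (\sum_x mu x * \sum_z heat L 1 x z * L z y).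
  apply: is_derive_sum_seq => x; apply: is_derive_scale; rewrite -heat_commute.
  exact: heat_derive.
have dc : is_derive (1 : R) (1 : R) g 0.
  have e : \forall t \near (1 : R), (cst (mu y) : R -> R) t = g t.
    near=> t; rewrite /g/= hstat// ltW//; near: t; apply: lt_nbhsr; exact: ltr01.
  exact: (near_eq_is_derive e).
transitivity ('D_1 g 1); last by case: dc.
have [_ ->] := dg.
under [RHS]eq_bigr do rewrite mulr_sumr.
 rewrite exchange_big/=;  apply: eq_bigr => z _.
under eq_bigr do rewrite mulrA.
by rewrite -mulr_suml hstat.
Unshelve. all: by end_near.
Qed.

End Stationary.
End Generator.

(** * Product semigroups *)

Section MarkovKernel.
Context {R : realType} {Y : finType} (K : Y -> Y -> R) (w : Y -> R).
Hypotheses (K_gt0 : forall x y, 0 < K x y) (K_sum : forall x, \sum_y K x y = 1).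
Hypotheses (w_gt0 : forall x, 0 < w x) (w_sum : \sum_x w x = 1).
Hypothesis w_inv : forall y, \sum_x w x * K x y = w y.
Implicit Types h : Y -> R.

Definition kernel_app h x : R := \sum_y K x y * h y.

Lemma expect_kernel h : expect w (kernel_app h) = expect w h.
Proof.
rewrite /expect /kernel_app; under eq_bigr do rewrite mulr_sumr.
rewrite exchange_big/=; apply: eq_bigr => y _.
by under eq_bigr do rewrite mulrA; rewrite -mulr_suml w_inv.
Qed.

Lemma moment_kernel_lt q h : 1 < q -> (forall x, 0 <= h x) ->
  ~ (exists c, forall x, h x = c) -> moment w q (kernel_app h) < moment w q h.
Proof.
move=> q1 h0 hn; rewrite [ltRHS]/moment -expect_kernel.
have [z _] := nonconst_neq hn 0.
have lt x : kernel_app h x `^ q < kernel_app (fun y => h y `^ q) x.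
  exact: powR_mean_lt.
apply: (@ltr_sum_point _ _ z) => [x|]; last by rewrite ltr_pM2l.
by rewrite ler_pM2l// ltW.
Qed.

(** Doeblin: K dominates a small multiple of [1 (x) w], so each application of
    K contracts the excess of [h] over its mean. *)
Lemma kernel_contraction : exists2 e : R, 0 < e <= 1 & forall h (b : R),
  (forall x, h x <= expect w h + b) ->
  forall x, kernel_app h x <= expect w h + (1 - e) * b.
Proof.
have [z0|Y0] := pickP (fun _ : Y => true); last first.
  exists 1; first by rewrite ltr01 lexx.
  by move=> h b _ x; have := Y0 x.
(* A crude positive lower bound for all the entries of K; it serves as w <= 1. *)
move=> _; pose e := \prod_x \prod_y Num.min 1 (K x y).
have m0 x y : 0 < Num.min 1 (K x y) by rewrite lt_min ltr01 K_gt0.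
have m1 x y : Num.min 1 (K x y) <= 1 by rewrite ge_min lexx.
have r0 x : 0 < \prod_y Num.min 1 (K x y) by exact: prodr_gt0.
have r1 x : \prod_y Num.min 1 (K x y) <= 1.
  by apply: prodr_ile1 => y _; rewrite m1 (ltW (m0 _ _)).
have eK x y : e <= K x y.
  rewrite /e (bigD1 x)//= (bigD1 y)//=.
  rewrite -[leRHS]mulr1 ler_pM//.
  - by rewrite mulr_ge0 ?prodr_ge0// => *; rewrite ltW.
  - by rewrite prodr_ge0// => *; rewrite ltW.
  - rewrite -[leRHS]mulr1 ler_pM// ?prodr_ge0 ?(ltW (m0 _ _))//.
    + by move=> *; rewrite ltW.
    + by rewrite ge_min lexx orbT.
    + by apply: prodr_ile1 => y' _; rewrite m1 (ltW (m0 _ _)).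
  - by apply: prodr_ile1 => x' _; rewrite r1 (ltW (r0 _)).
exists e.
  by rewrite prodr_gt0//=; apply: prodr_ile1 => x _; rewrite r1 (ltW (r0 _)).
have w1 y : w y <= 1.
  by rewrite -w_sum (bigD1 y)//= lerDl sumr_ge0// => *; exact: ltW.
have e0 : 0 < e by rewrite prodr_gt0.
move=> h b hb x; set m := expect w h.
have -> : kernel_app h x = \sum_y (K x y - e * w y) * h y + e * m.
  rewrite /m /expect mulr_sumr -big_split/=; apply: eq_bigr => y _; ring.
have -> : m + (1 - e) * b = \sum_y (K x y - e * w y) * (m + b) + e * m.
  by rewrite -mulr_suml sumrB K_sum -mulr_sumr w_sum; ring.
rewrite lerD2r; apply: ler_sum => y _; apply: ler_wpM2l => //.
rewrite subr_ge0; apply: le_trans (eK x y).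
by rewrite ler_piMr ?(ltW e0).
Qed.

End MarkovKernel.

Section Updates.
Context {R : realType} {X : finType} {n : nat}.
Local Notation Y := {ffun 'I_n -> X}.
Implicit Types (x y : Y) (i j : 'I_n) (z : X).

Definition update x i z : Y := [ffun j => if j == i then z else x j].

Lemma update_same x i z : update x i z i = z.
Proof. by rewrite ffunE eqxx. Qed.

Lemma update_other x i z j : j != i -> update x i z j = x j.
Proof. by rewrite ffunE => /negbTE->. Qed.

Lemma update_id x i : update x i (x i) = x.
Proof. by apply/ffunP => j; rewrite ffunE; case: eqVneq => [->|]. Qed.

Lemma update_update x i z z' : update (update x i z) i z' = update x i z'.
Proof. by apply/ffunP => j; rewrite !ffunE; case: eqVneq. Qed.

Lemma updateC x i j z z' : i != j ->
  update (update x i z) j z' = update (update x j z') i z.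
Proof.
move=> ij; apply/ffunP => k; rewrite !ffunE.
by case: (eqVneq k j) => [->|//]; rewrite eq_sym (negbTE ij).
Qed.

Lemma prod_update (F : 'I_n -> X -> R) x i z :
  \prod_j F j (update x i z j) = F i z * \prod_(j | j != i) F j (x j).
Proof.
rewrite (bigD1 i)//= update_same; congr (_ * _).
by apply: eq_bigr => j ji; rewrite update_other.
Qed.

End Updates.

Lemma is_derive_prod_seq {R : realType} {I : eqType} (r : seq I) (k : I -> R -> R)
    (d : I -> R) (t : R) : uniq r ->
  (forall i, is_derive t (1 : R) (k i) (d i)) ->
  is_derive t (1 : R) (fun s => \prod_(i <- r) k i s)
    (\sum_(i <- r) \prod_(j <- r) if j == i then d j else k j t).
Proof.
move=> + kd; elim: r => [|i r IH] /=.
  by rewrite big_nil; under eq_fun do rewrite big_nil; move=> _; exact: is_derive_cst.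
move=> /andP[ir /IH{}IH]; under eq_fun do rewrite big_cons.
have dp : is_derive t (1 : R) (fun s => k i s * \prod_(j <- r) k j s) _ :=
  is_deriveM (kd i) IH.
apply: (is_derive_eq dp); rewrite big_cons [in RHS]big_cons eqxx addrC.
rewrite /GRing.scale/= mulrC; congr (_ * _ + _).
  by apply: eq_big_seq => j jr; case: eqVneq => // ji; rewrite -ji jr in ir.
rewrite mulr_sumr; apply: eq_big_seq => j jr; rewrite big_cons.
by case: eqVneq => // ij; rewrite ij jr in ir.
Qed.

Section ProductSemigroup.
Context {R : realType} {X : finType} {n : nat} (L : X -> X -> R).
Local Notation Y := {ffun 'I_n -> X}.
Implicit Types (x y : Y) (i j : 'I_n) (z : X) (t s : R) (f : Y -> R).

Definition prod_kernel t x y : R := \prod_i heat L t (x i) (y i).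

Definition prod_generator x y : R :=
  \sum_i \sum_z L (x i) z * (update x i z == y)%:R.

Lemma prod_generatorE f x :
  \sum_y prod_generator x y * f y = \sum_i \sum_z L (x i) z * f (update x i z).
Proof.
under eq_bigr do rewrite mulr_suml.
rewrite exchange_big/=; apply: eq_bigr => i _.
under eq_bigr do rewrite mulr_suml.
rewrite exchange_big/=; apply: eq_bigr => z _.
by under eq_bigr do rewrite -mulrA; rewrite -mulr_sumr sum_delta.
Qed.

Lemma prod_kernel_derive t x y :
  is_derive t (1 : R) (fun s => prod_kernel s x y)
    (\sum_i \sum_z L (x i) z * prod_kernel t (update x i z) y).
Proof.
have dk i : is_derive t (1 : R) (fun s => heat L s (x i) (y i)) _ := heat_derive L t (x i) (y i).
apply: (is_derive_eq (is_derive_prod_seq (index_enum_uniq _) dk)).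
apply: eq_bigr => i _; rewrite (bigD1 i)//= eqxx mulr_suml; apply: eq_bigr => z _.
rewrite /prod_kernel (prod_update (fun j => (heat L t)^~ (y j))) mulrA; congr (_ * _).
by apply: eq_bigr => j /negbTE->.
Qed.

Lemma prod_semigroup_derive f t x :
  is_derive t (1 : R) (fun s => prod_semigroup L s f x)
    (\sum_y prod_generator x y * prod_semigroup L t f y).
Proof.
have dk y : is_derive t (1 : R) (fun s => prod_kernel s x y * f y)
    (f y * \sum_i \sum_z L (x i) z * prod_kernel t (update x i z) y).
  by under eq_fun do rewrite mulrC; exact: is_derive_scale (prod_kernel_derive t x y).
apply: (is_derive_eq (is_derive_sum_seq (index_enum _) dk)).
rewrite prod_generatorE /prod_semigroup.
under eq_bigr do rewrite mulr_sumr.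
rewrite exchange_big/=; apply: eq_bigr => i _.
under eq_bigr do rewrite mulr_sumr.
rewrite exchange_big/=; apply: eq_bigr => z _.
by rewrite mulr_sumr; apply: eq_bigr => y _; rewrite /prod_kernel; ring.
Qed.

Lemma prod_semigroup0 f : prod_semigroup L 0 f = f.
Proof.
apply/funext => x; rewrite /prod_semigroup -[RHS](sum_delta f x).
apply: eq_bigr => y _; congr (_ * _).
have [->|xy] := eqVneq x y; first by apply: big1 => i _; rewrite heat0 eqxx.
have [i xyi] : exists i, x i != y i.
  by apply/existsP; rewrite -negb_forall; apply: contra xy => /forallP h; apply/eqP/ffunP => i; apply/eqP.
by rewrite (bigD1 i)//= heat0 (negbTE xyi) mul0r.
Qed.

Lemma prod_semigroupD s t f :
  prod_semigroup L (s + t) f = prod_semigroup L s (prod_semigroup L t f).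
Proof.
apply/funext => x; rewrite /prod_semigroup.
under [RHS]eq_bigr do rewrite mulr_sumr.
rewrite exchange_big/=; apply: eq_bigr => y _.
under [RHS]eq_bigr do rewrite mulrA.
rewrite -mulr_suml; congr (_ * _).
under eq_bigr do rewrite heatD.
rewrite bigA_distr_bigA/=; apply: eq_bigr => z _.
by rewrite big_split.
Qed.

Lemma prod_semigroupZ t f (c : R) :
  prod_semigroup L t (fun x => c * f x) = (fun x => c * prod_semigroup L t f x).
Proof.
by apply/funext => x; rewrite /prod_semigroup mulr_sumr; apply: eq_bigr => y _; rewrite mulrCA.
Qed.

Hypotheses (hL : is_generator L) (hirr : irreducible L).

Lemma prod_kernel_gt0 t x y : 0 < t -> 0 < prod_kernel t x y.
Proof. by move=> t0; apply: prodr_gt0 => i _; exact: heat_gt0. Qed.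

Lemma prod_kernel_sum t x : \sum_y prod_kernel t x y = 1.
Proof.
have [_ L0] := hL; rewrite -(bigA_distr_bigA (fun i => heat L t (x i))).
by apply: big1 => i _; exact: heat_row_sum.
Qed.

Lemma prod_semigroup_cst t (c : R) : prod_semigroup L t (fun=> c : R) = (fun x : Y => c).
Proof.
apply/funext => x; rewrite /prod_semigroup -mulr_suml.
by rewrite -/(prod_kernel t x) (prod_kernel_sum t x) mul1r.
Qed.

(** The semigroup extends to negative times: if P_t f is the constant c, then
    f = P_(-t) c = c. *)
Lemma prod_semigroup_nonconst t f : ~ (exists c, forall x, f x = c) ->
  ~ (exists c, forall x, prod_semigroup L t f x = c).
Proof.
move=> fn [c fc]; apply: fn; exists c => x.
rewrite -[f]prod_semigroup0 -(addNr t) prod_semigroupD.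
have -> : prod_semigroup L t f = fun=> c by apply/funext.
by rewrite prod_semigroup_cst.
Qed.

Lemma prod_semigroup_gt0 t f : (forall x, 0 <= f x) ->
  ~ (exists c, forall x, f x = c) -> 0 < t -> forall x, 0 < prod_semigroup L t f x.
Proof.
move=> f0 fn t0 x; have [y fy] := nonconst_neq fn 0.
rewrite /prod_semigroup (bigD1 y)//= ltr_pwDl//.
  by rewrite mulr_gt0 ?prod_kernel_gt0// lt_neqAle eq_sym fy f0.
by apply: sumr_ge0 => z _; rewrite mulr_ge0// ltW// prod_kernel_gt0.
Qed.

Lemma prod_semigroup_ge0 t f : (forall x, 0 <= f x) -> 0 <= t ->
  forall x, 0 <= prod_semigroup L t f x.
Proof.
move=> f0; rewrite le_eqVlt => /predU1P[<- x|t0 x]; first by rewrite prod_semigroup0.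
by apply: sumr_ge0 => y _; rewrite mulr_ge0// ltW// prod_kernel_gt0.
Qed.

Context (mu : X -> R).
Hypotheses (hmu : is_prob mu) (hstat : stationary L mu).
Local Notation w := (@prod_measure R X n mu).

Lemma prod_measure_gt0 x : 0 < w x.
Proof. by apply: prodr_gt0 => i _; exact: (stationary_gt0 hL hirr hmu hstat). Qed.

Lemma prod_measure_sum : \sum_x w x = 1.
Proof.
rewrite -(bigA_distr_bigA (fun i : 'I_n => mu)).
by apply: big1 => i _; case: hmu.
Qed.

Lemma prod_measure_kernel t y : 0 <= t -> \sum_x w x * prod_kernel t x y = w y.
Proof.
move=> t0; under eq_bigr do rewrite -big_split/=.
rewrite -(bigA_distr_bigA (fun i z => mu z * heat L t z (y i))).
by apply: eq_bigr => i _; exact: hstat.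
Qed.

Lemma expect_prod_semigroup t f : 0 <= t -> expect w (prod_semigroup L t f) = expect w f.
Proof.
by move=> t0; apply: (expect_kernel (K := prod_kernel t)) => y; exact: prod_measure_kernel.
Qed.

Lemma prod_moment_decreasing s t q f : (forall x, 0 <= f x) ->
  ~ (exists c, forall x, f x = c) -> 0 <= s < t -> 1 < q ->
  moment w q (prod_semigroup L t f) < moment w q (prod_semigroup L s f).
Proof.
move=> f0 fn /andP[s0 st] q1.
rewrite -(subrK s t) prod_semigroupD.
have ts : 0 < t - s by rewrite subr_gt0.
apply: (moment_kernel_lt (K := prod_kernel (t - s))) => //.
- by move=> x y; exact: prod_kernel_gt0.
- exact: prod_kernel_sum.
- exact: prod_measure_gt0.
- by move=> y; apply: prod_measure_kernel; exact: ltW.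
- exact: prod_semigroup_ge0.
- exact: prod_semigroup_nonconst.
Qed.

Lemma prod_semigroup_eventually_lt f (c : R) : expect w f < c ->
  exists2 t, 0 <= t & forall x, prod_semigroup L t f x < c.
Proof.
move=> fc; set m := expect w f.
have [e /andP[e0 e1] He] := @kernel_contraction _ _ (prod_kernel 1) w
  (fun x y => prod_kernel_gt0 x y ltr01) (prod_kernel_sum 1) prod_measure_gt0 prod_measure_sum.
pose b := \sum_x `|f x - m|.
have fb x : f x <= m + b.
  rewrite -lerBlDl; apply: le_trans (ler_norm _) _.
  by rewrite /b (bigD1 x)//= lerDl sumr_ge0.
have step k x : prod_semigroup L k%:R f x <= m + (1 - e) ^+ k * b.
  elim: k x => [|k IH] x; first by rewrite prod_semigroup0 expr0 mul1r.
  rewrite -nat1r prod_semigroupD exprS -mulrA.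
  have em : expect w (prod_semigroup L k%:R f) = m by rewrite expect_prod_semigroup.
  by rewrite -em; apply: He => y; rewrite em.
have cv : m + (1 - e) ^+ k * b @[k --> \oo] --> m + 0 * b.
  apply: cvgD; first exact: cvg_cst.
  apply: cvgMr_tmp; apply: cvg_expr; rewrite ger0_norm; lra.
rewrite mul0r addr0 in cv.
have [k _ /(_ k (leqnn k)) hk] := cvgr_lt _ cv _ fc.
exists k%:R => // x; exact: le_lt_trans (step k x) hk.
Qed.

End ProductSemigroup.

(** * Entropy and nonlinear log-Sobolev inequalities on product spaces *)

Section Averaging.
Context {R : realType} {X : finType} {n : nat} (mu : X -> R).
Hypotheses (mu_gt0 : forall z, 0 < mu z) (mu_sum : \sum_z mu z = 1).
Local Notation Y := {ffun 'I_n -> X}.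
Local Notation w := (@prod_measure R X n mu).
Implicit Types (x y : Y) (i j : 'I_n) (z : X) (h k v : Y -> R) (s : seq 'I_n).

(** The conditional expectation given all coordinates but the [i]-th. *)
Definition avg i h x : R := \sum_z mu z * h (update x i z).

Definition indep i h := forall x z, h (update x i z) = h x.

Lemma avg_indep i h : indep i (avg i h).
Proof. by move=> x z; apply: eq_bigr => z' _; rewrite update_update. Qed.

Lemma indep_avg i j h : indep j h -> indep j (avg i h).
Proof.
have [->|ij] := eqVneq i j; first by move=> _; exact: avg_indep.
move=> hj x z; apply: eq_bigr => z' _.
by rewrite updateC 1?eq_sym// hj.
Qed.

Lemma avg_mul_indep i v h x : indep i v -> avg i (fun y => v y * h y) x = v x * avg i h x.
Proof.
move=> vi; rewrite /avg mulr_sumr; apply: eq_bigr => z _.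
by rewrite vi mulrCA.
Qed.

Lemma avg_ge0 i h : (forall x, 0 <= h x) -> forall x, 0 <= avg i h x.
Proof. by move=> h0 x; apply: sumr_ge0 => z _; rewrite mulr_ge0// ltW. Qed.

Lemma avg_gt0 i h x : (forall x, 0 <= h x) -> 0 < h x -> 0 < avg i h x.
Proof.
move=> h0 hx; rewrite /avg (bigD1 (x i))//= update_id ltr_pwDl ?mulr_gt0//.
by apply: sumr_ge0 => z _; rewrite mulr_ge0// ltW.
Qed.

(* The exchange (x, z) <-> (update x i z, x i) preserves the weight w x * mu z. *)
Lemma expect_avg i h : expect w (avg i h) = expect w h.
Proof.
transitivity (\sum_(q : Y * X) w q.1 * mu q.2 * h (update q.1 i q.2)).
  rewrite /expect -(pair_bigA _ (fun x z => w x * mu z * h (update x i z)))/=.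
  by apply: eq_bigr => x _; rewrite mulr_sumr; apply: eq_bigr => z _; rewrite mulrA.
pose swap (q : Y * X) := (update q.1 i q.2, q.1 i).
have swapK : involutive swap.
  by move=> [x z]; rewrite /swap/= update_update update_id update_same.
rewrite (reindex_inj (inv_inj swapK))/=.
transitivity (\sum_(q : Y * X) w q.1 * h q.1 * mu q.2).
  apply: eq_bigr => -[x z] _ /=; rewrite update_update update_id [RHS]mulrAC; congr (_ * _).
  rewrite /prod_measure (prod_update (fun _ => mu)) [in RHS](bigD1 i)//=.
  by ring.
rewrite -(pair_bigA _ (fun x z => w x * h x * mu z))/=.
by apply: eq_bigr => x _; rewrite -mulr_sumr mu_sum mulr1.
Qed.

Let w_ge0 x : 0 <= w x.
Proof. by apply: prodr_ge0 => i _; exact: ltW. Qed.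

(** Averaging over coordinate [i] loses less entropy on a conditional
    expectation [k] of [h] than on [h] itself: this is [ln r <= r - 1] for the
    ratio [r] of the two densities, whose mean is at most 1 because
    [avg i h / avg i k] does not depend on coordinate [i]. *)
Lemma avg_entropy_le i h k : (forall x, 0 <= h x) -> (forall x, 0 <= k x) ->
  (forall x, 0 < h x -> 0 < k x) -> expect w k = expect w h ->
  expect w (fun x => h x * ln (k x / avg i k x)) <=
  expect w (fun x => h x * ln (h x / avg i h x)).
Proof.
move=> h0 k0 hk ek; pose v x := avg i h x / avg i k x.
have v0 x : 0 <= v x by rewrite divr_ge0// avg_ge0.
have vi : indep i v by move=> x z; rewrite /v !avg_indep.
have ev : expect w (fun x => v x * k x) <= expect w h.
  rewrite -(expect_avg i) -[leRHS](expect_avg i); apply: ler_sum => x _.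
  apply: ler_wpM2l => //; rewrite avg_mul_indep// /v.
  have [->|kn0] := eqVneq (avg i k x) 0; first by rewrite mulr0 avg_ge0.
  by rewrite divfK.
rewrite -subr_le0; apply: (@le_trans _ _ (expect w (fun x => v x * k x) - expect w h)).
  rewrite /expect -!sumrB; apply: ler_sum => x _; rewrite -!mulrBr ler_wpM2l//.
  have [hx|] := ltP 0 (h x); last first.
    move=> hx; have -> : h x = 0 by apply/eqP; rewrite eq_le hx h0.
    by rewrite !mul0r !subr0 mulr_ge0.
  have kx := hk x hx; have ahx := avg_gt0 i h0 hx; have akx := avg_gt0 i k0 kx.
  rewrite -ln_div ?posrE ?divr_gt0//.
  have r0 : 0 < v x * k x / h x by rewrite divr_gt0// mulr_gt0// divr_gt0.
  have -> : k x / avg i k x / (h x / avg i h x) = 1 + (v x * k x / h x - 1).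
    by rewrite /v; field; rewrite !gt_eqF.
  have -> : v x * k x - h x = h x * (v x * k x / h x - 1).
    by rewrite mulrBr mulr1 mulrCA mulfV ?mulr1// gt_eqF.
  by rewrite ler_pM2l// le_ln1Dx//; lra.
by rewrite subr_le0.
Qed.

Definition avgs s h : Y -> R := foldr avg h s.

Lemma avgs_ge0 s h : (forall x, 0 <= h x) -> forall x, 0 <= avgs s h x.
Proof. by move=> h0; elim: s => //= i s IH; exact: avg_ge0. Qed.

Lemma avgs_gt0 s h x : (forall x, 0 <= h x) -> 0 < h x -> 0 < avgs s h x.
Proof.
by move=> h0 hx; elim: s => //= i s IH; apply: avg_gt0 => //; exact: avgs_ge0.
Qed.

Lemma expect_avgs s h : expect w (avgs s h) = expect w h.
Proof. by elim: s => //= i s IH; rewrite expect_avg. Qed.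

Lemma avgs_indep s h i : i \in s -> indep i (avgs s h).
Proof.
elim: s => //= j s IH; rewrite inE => /predU1P[->|/IH]; first exact: avg_indep.
exact: indep_avg.
Qed.

Lemma indep_all_cst h : (forall i, indep i h) -> forall x y, h x = h y.
Proof.
move=> hi x y; pose b s := foldr (fun i x' => update x' i (y i)) x s.
have hb s : h (b s) = h x by elim: s => //= i s IH; rewrite hi.
have bE s j : b s j = if j \in s then y j else x j.
  elim: s => //= i s IH; rewrite ffunE inE; case: eqVneq => [->|_] //=.
rewrite -(hb (enum 'I_n)); congr h; apply/ffunP => j.
by rewrite bE mem_enum.
Qed.

Lemma avgs_entropy_le s h : (forall x, 0 <= h x) ->
  expect w (fun x => h x * ln (h x / avgs s h x)) <=
  \sum_(i <- s) expect w (fun x => h x * ln (h x / avg i h x)).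
Proof.
move=> h0; elim: s => [|i s IH].
  rewrite big_nil /expect big1// => x _ /=.
  have [->|hx] := eqVneq (h x) 0; first by rewrite mul0r mulr0.
  by rewrite divff// ln1 !mulr0.
rewrite big_cons /=; have := avg_entropy_le i h0 (avgs_ge0 s h0)
  (fun x => @avgs_gt0 s h x h0) (expect_avgs s h).
move=> /lerD/(_ IH); apply: le_trans; rewrite le_eqVlt; apply/orP; left; apply/eqP.
rewrite /expect -big_split/=; apply: eq_bigr => x _; rewrite -mulrDr; congr (_ * _).
have [hx|] := ltP 0 (h x); last first.
  by move=> hx; have -> : h x = 0 by [apply/eqP; rewrite eq_le hx h0]; rewrite !mul0r addr0.
have kx := avgs_gt0 s h0 hx; have akx := avg_gt0 i (avgs_ge0 s h0) kx.
rewrite -mulrDr -lnM ?posrE ?divr_gt0//; congr (_ * ln _).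
by field; rewrite !gt_eqF.
Qed.

Lemma expect_prod_cst (c : R) : expect w (fun=> c) = c.
Proof.
rewrite /expect -mulr_suml -(bigA_distr_bigA (fun i : 'I_n => mu)).
by rewrite big1 ?mul1r// => i _.
Qed.

(** Averaging out the coordinates one after the other leads from [h] to its mean,
    and the entropy telescopes along the way; each step costs at most the
    entropy of [h] in that coordinate alone. *)
Lemma entropy_subadditive h : (forall x, 0 <= h x) ->
  entropy w h <= \sum_i expect w (fun x => entropy mu (fun z => h (update x i z))).
Proof.
move=> h0; have full x : avgs (enum 'I_n) h x = expect w h.
  rewrite -[RHS](expect_avgs (enum 'I_n)) -[LHS]expect_prod_cst.
  apply: eq_bigr => y _; congr (_ * _); apply: indep_all_cst => i.
  by apply: avgs_indep; rewrite mem_enum.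
have := avgs_entropy_le (enum 'I_n) h0.
rewrite big_enum/= => le; apply: le_trans (le_trans le _).
  rewrite le_eqVlt; apply/orP; left; apply/eqP.
  by apply: eq_bigr => x _; rewrite full.
apply: ler_sum => i _; rewrite -(expect_avg i).
rewrite le_eqVlt; apply/orP; left; apply/eqP.
apply: eq_bigr => x _; congr (_ * _); apply: eq_bigr => z _.
by rewrite avg_indep.
Qed.

End Averaging.

Section ConcaveGauge.
Context {R : realType} (Phi : R -> R).
Hypothesis hPhi : lsi_gauge Phi.
Implicit Types (a b d e t x y : R).

Lemma gauge_concave t x y : 0 <= t <= 1 -> 0 <= x -> 0 <= y ->
  t * Phi x + (1 - t) * Phi y <= Phi (t * x + (1 - t) * y).
Proof.
move=> /andP[t0 t1] x0 y0; have [hc _ _ _] := hPhi.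
have xI : x \in (`[0, +oo[%classic : set R^o) by rewrite inE/= in_itv/= x0.
have yI : y \in (`[0, +oo[%classic : set R^o) by rewrite inE/= in_itv/= y0.
have h : - Phi (t * x + (1 - t) * y) <= t * (- Phi x) + (1 - t) * (- Phi y) :=
  hc (Itv01 t0 t1) _ _ xI yI.
by lra.
Qed.

(** Concavity at the points d1 / e1 and d2 / e2 with weights proportional to e1
    and e2.  This homogeneous form of Jensen's inequality admits zero weights,
    which occur on the lines where a function vanishes. *)
Lemma gauge_perspective d1 e1 d2 e2 : 0 <= e1 -> 0 <= e2 -> 0 <= d1 -> 0 <= d2 ->
  (e1 = 0 -> d1 = 0) -> (e2 = 0 -> d2 = 0) ->
  e1 * Phi (d1 / e1) + e2 * Phi (d2 / e2) <= (e1 + e2) * Phi ((d1 + d2) / (e1 + e2)).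
Proof.
rewrite le_eqVlt => /predU1P[<- _ _ _ /(_ erefl)-> _|e1_gt0].
  by rewrite mul0r !add0r.
rewrite le_eqVlt => /predU1P[<- _ _ _ /(_ erefl)->|e2_gt0 d1_ge0 d2_ge0 _ _].
  by rewrite mul0r !addr0.
have S0 : 0 < e1 + e2 by rewrite addr_gt0.
have t01 : 0 <= e1 / (e1 + e2) <= 1.
  by rewrite divr_ge0 ?(ltW e1_gt0) ?(ltW S0)//= ler_pdivrMr// mul1r lerDl ltW.
have x0 : 0 <= d1 / e1 by rewrite divr_ge0// ltW.
have y0 : 0 <= d2 / e2 by rewrite divr_ge0// ltW.
have := gauge_concave t01 x0 y0.
rewrite -(ler_pM2l S0).
have -> : e1 / (e1 + e2) * (d1 / e1) + (1 - e1 / (e1 + e2)) * (d2 / e2) =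
    (d1 + d2) / (e1 + e2) by field; rewrite !gt_eqF.
apply: le_trans; rewrite le_eqVlt; apply/orP; left; apply/eqP.
by field; rewrite !gt_eqF.
Qed.

Lemma gauge_perspective_sum (T : Type) (r : seq T) (d e : T -> R) :
  (forall i : T, 0 <= e i) -> (forall i : T, 0 <= d i) ->
  (forall i : T, e i = 0 -> d i = 0) ->
  \sum_(i <- r) e i * Phi (d i / e i) <=
  (\sum_(i <- r) e i) * Phi ((\sum_(i <- r) d i) / \sum_(i <- r) e i).
Proof.
move=> e0 d0 ed.
have sum0 s : \sum_(i <- s) e i = 0 -> \sum_(i <- s) d i = 0.
  elim: s => [|i s IH]; first by rewrite !big_nil.
  rewrite !big_cons => /eqP; rewrite paddr_eq0 ?sumr_ge0//.
  by move=> /andP[/eqP/ed-> /eqP/IH->]; rewrite addr0.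
elim: r => [|i r IH]; first by rewrite !big_nil mul0r.
rewrite !big_cons; apply: le_trans (gauge_perspective _ _ _ _ (@ed i) (@sum0 r)).
- by rewrite lerD2l.
- exact: e0.
- exact: sumr_ge0.
- exact: d0.
- exact: sumr_ge0.
Qed.

(** Concavity and [Phi 0 = 0] give [Phi (x y / z) >= y] when [Phi x >= z >= y]. *)
Lemma lsi_inverse_le x y z : 0 <= x -> 0 < y <= z -> z <= Phi x ->
  (lsi_inverse Phi y <= (x * y / z)%:E)%E.
Proof.
move=> x0 /andP[y0 yz] zP; have [_ _ _ P0] := hPhi.
have z0 : 0 < z by exact: lt_le_trans yz.
apply: ereal_inf_lbound; exists (x * y / z) => //; split.
  by rewrite divr_ge0 ?mulr_ge0// ltW.
have t01 : 0 <= y / z <= 1 by rewrite divr_ge0 ?(ltW y0) ?(ltW z0)//= ler_pdivrMr// mul1r.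
have := gauge_concave t01 x0 (lexx 0).
have -> : x * y / z = y / z * x by ring.
rewrite P0 !mulr0 !addr0; apply: le_trans.
by rewrite mulrAC ler_pdivlMr// ler_pM2l.
Qed.


End ConcaveGauge.

Section Tensorization.
Context {R : realType} {X : finType} (L : X -> X -> R) (mu : X -> R).
Hypothesis hL : is_generator L.
Hypotheses (mu_gt0 : forall z, 0 < mu z) (mu_sum : \sum_z mu z = 1).
Hypothesis mu_inv : forall z, \sum_x mu x * L x z = 0.

(** Integrate the tangent inequality p a^(p-1) (b - a) <= b^p - a^p against L. *)
Lemma dirichlet_ge0 (p : R) (g : X -> R) : 1 < p -> (forall x, 0 <= g x) ->
  0 <= dirichlet L mu g (fun x => g x `^ (p - 1)).
Proof.
move=> p1 g0; have [Lpos L0] := hL; have p_gt0 : 0 < p by lra.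
rewrite /dirichlet oppr_ge0 -(ler_pM2l p_gt0) mulr0.
apply: (@le_trans _ _ (\sum_x \sum_y mu x * L x y * (g y `^ p - g x `^ p))).
  rewrite mulr_sumr; apply: ler_sum => x _.
  have -> : p * \sum_y L x y * g y * g x `^ (p - 1) * mu x =
      \sum_y mu x * L x y * (p * g x `^ (p - 1) * (g y - g x)).
    rewrite mulr_sumr; apply/eqP; rewrite -subr_eq0 -sumrB; apply/eqP.
    rewrite (eq_bigr (fun y => mu x * p * g x `^ (p - 1) * g x * L x y)).
      by rewrite -mulr_sumr L0 mulr0.
    by move=> y _; ring.
  apply: ler_sum => y _; have [->|xy] := eqVneq x y.
    by rewrite !subrr !mulr0.
  by apply: ler_wpM2l; [rewrite mulr_ge0 ?Lpos// ltW|exact: powR_tangent_le].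
under eq_bigr do (under eq_bigr do rewrite mulrBr; rewrite sumrB).
rewrite sumrB exchange_big/= [X in X - _]big1 ?[X in _ - X]big1 ?subrr//.
  by move=> x _; rewrite -mulr_suml -mulr_sumr L0 mulr0 mul0r.
by move=> y _; rewrite -mulr_suml mu_inv mul0r.
Qed.

Context {n : nat}.
Local Notation Y := {ffun 'I_n -> X}.
Local Notation w := (@prod_measure R X n mu).

(** The Dirichlet form of the product generator, E(g, g^(p-1)). *)
Definition prod_dirichlet (p : R) (g : Y -> R) : R :=
  - expect w (fun x => g x `^ (p - 1) * \sum_y prod_generator L x y * g y).

Lemma prod_dirichletE p g : prod_dirichlet p g = \sum_i expect w (fun x =>
  dirichlet L mu (fun z => g (update x i z)) (fun z => g (update x i z) `^ (p - 1))).
Proof.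
pose d i x := - (g x `^ (p - 1) * \sum_z L (x i) z * g (update x i z)).
transitivity (\sum_i expect w (d i)).
  rewrite /prod_dirichlet /expect -sumrN exchange_big/=; apply: eq_bigr => x _.
  rewrite prod_generatorE -mulrN -mulr_sumr; congr (_ * _).
  by rewrite /d sumrN mulr_sumr.
apply: eq_bigr => i _; rewrite -(expect_avg mu_sum i).
apply: eq_bigr => x _; congr (_ * _).
rewrite /avg /dirichlet /d -sumrN; apply: eq_bigr => a _.
rewrite mulrN; congr (- _); rewrite update_same mulr_sumr mulr_sumr.
by apply: eq_bigr => b _; rewrite update_update; ring.
Qed.

(** The one-site inequality, applied to every line of the product space,
    survives summation because entropy is subadditive, the Dirichlet form is
    additive, and concavity of [Phi] absorbs the averaging. *)
Lemma lsi_tensorization p Phi (g : Y -> R) : 1 < p -> lsi_gauge Phi ->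
  admits_lsi L mu p Phi -> (forall x, 0 <= g x) ->
  entropy w (fun x => g x `^ p) <= n%:R * moment w p g *
    Phi (prod_dirichlet p g / (n%:R * moment w p g)).
Proof.
move=> p1 hPhi lsi g0; have p0 : p != 0 by rewrite gt_eqF//; lra.
have pm0 : p - 1 != 0 by rewrite subr_eq0 gt_eqF.
pose e i x := expect mu (fun z => g (update x i z) `^ p).
pose d i x := dirichlet L mu (fun z => g (update x i z)) (fun z => g (update x i z) `^ (p - 1)).
have w0 x : 0 < w x by apply: prodr_gt0.
have e0 i x : 0 <= e i x.
  by apply: sumr_ge0 => z _; rewrite mulr_ge0 ?powR_ge0// ltW.
have d0 i x : 0 <= d i x by exact: dirichlet_ge0.
have g_line i x : e i x = 0 -> forall z, g (update x i z) = 0.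
  move=> /eqP; rewrite psumr_eq0 => [/allP h z|z _]; last first.
    by rewrite mulr_ge0 ?powR_ge0// ltW.
  have := h z (mem_index_enum _); rewrite mulf_eq0 gt_eqF//= => /eqP.
  exact: powR_eq0_eq0.
have ed i x : e i x = 0 -> d i x = 0.
  move=> /g_line h; rewrite /d /dirichlet big1 ?oppr0// => a _.
  by rewrite big1// => b _; rewrite !h mulr0 !mul0r.
have line i x : entropy mu (fun z => g (update x i z) `^ p) <= e i x * Phi (d i x / e i x).
  have [ei|en] := eqVneq (e i x) 0.
    rewrite ei mul0r /entropy /expect big1// => z _.
    by rewrite (g_line i x ei) powR0// mul0r mulr0.
  have ep : 0 < e i x by rewrite lt_neqAle eq_sym en e0.
  by rewrite mulrC -ler_pdivrMr//; apply: (lsi (fun z => g (update x i z))).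
apply: le_trans (entropy_subadditive mu_gt0 mu_sum _) _.
  by move=> x; exact: powR_ge0.
have Ee i : \sum_x w x * e i x = moment w p g by exact: (expect_avg mu_sum i).
have Ed : \sum_i \sum_x w x * d i x = prod_dirichlet p g by rewrite prod_dirichletE.
have m0 : 0 <= moment w p g by apply: moment_ge0.
have wed i x : w x * e i x = 0 -> w x * d i x = 0.
  by move=> /eqP; rewrite mulf_eq0 gt_eqF//= => /eqP/ed->; rewrite mulr0.
apply: (@le_trans _ _ (\sum_i moment w p g * Phi ((\sum_x w x * d i x) / moment w p g))).
  apply: ler_sum => i _; rewrite -(Ee i).
  have := @gauge_perspective_sum _ Phi hPhi _ (index_enum Y) (fun x => w x * d i x) (fun x => w x * e i x).
  move=> h; apply: le_trans (h _ _ (wed i)); last 2 first.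
  - by move=> x; rewrite mulr_ge0// ltW.
  - by move=> x; rewrite mulr_ge0// ltW.
  apply: ler_sum => x _; rewrite -mulrA ler_pM2l//.
  by rewrite -mulf_div divff ?gt_eqF// mul1r.
have := @gauge_perspective_sum _ Phi hPhi _ (index_enum 'I_n) (fun i => \sum_x w x * d i x) (fun=> moment w p g).
move=> h; apply: le_trans (h _ _ _) _.
- by [].
- by move=> i; apply: sumr_ge0 => x _; rewrite mulr_ge0// ltW.
- move=> i mz; apply: big1 => x _; apply: wed; apply/eqP.
  have /eqP := Ee i; rewrite mz psumr_eq0 => [/allP/(_ x (mem_index_enum _))//|x' _].
  by rewrite mulr_ge0// ltW.
by rewrite Ed sumr_const card_ord mulr_natl.
Qed.

End Tensorization.

Section EntropyLowerBound.
Context {R : realType} {T : finType} (w : T -> R).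
Hypotheses (w_gt0 : forall x, 0 < w x) (w_sum : \sum_x w x = 1).

(** The tangent line at [p] of the convex function s |-> ln E[g^s], evaluated at
    s = 1; concretely it is ln r <= r - 1 for r = g^(1-p) / E[g]. *)
Lemma log_moment_ge p (g : T -> R) : 1 < p -> (forall x, 0 <= g x) ->
  moment w p g = 1 -> 0 < expect w g ->
  - ln (expect w g) <= (p - 1) * log_moment w p g.
Proof.
move=> p1 g0 mp m0; set m := expect w g; have p0 : 0 < p by lra.
have : \sum_x w x * ((1 - p) * (g x `^ p * ln (g x)) - g x `^ p * ln m) <=
       \sum_x w x * (g x / m - g x `^ p).
  apply: ler_sum => x _; rewrite ler_pM2l//.
  have := g0 x; rewrite le_eqVlt => /predU1P[<-|gx].
    by rewrite powR0 ?gt_eqF// !mul0r mulr0.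
  have gp : 0 < g x `^ p by rewrite powR_gt0.
  have r0 : 0 < g x / (g x `^ p * m) by rewrite divr_gt0// mulr_gt0.
  have -> : (1 - p) * (g x `^ p * ln (g x)) - g x `^ p * ln m =
      g x `^ p * ln (1 + (g x / (g x `^ p * m) - 1)).
    rewrite (_ : 1 + (_ - 1) = g x / (g x `^ p * m)); last by ring.
    rewrite ln_div ?posrE ?mulr_gt0// lnM ?posrE// ln_powR; ring.
  have -> : g x / m - g x `^ p = g x `^ p * (g x / (g x `^ p * m) - 1).
    by field; rewrite !gt_eqF.
  by rewrite ler_pM2l// le_ln1Dx//; lra.
have -> : \sum_x w x * ((1 - p) * (g x `^ p * ln (g x)) - g x `^ p * ln m) =
    (1 - p) * log_moment w p g - moment w p g * ln m.
  rewrite /log_moment /moment /expect mulr_sumr mulr_suml -sumrB.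
  by apply: eq_bigr => x _; ring.
have -> : \sum_x w x * (g x / m - g x `^ p) = m / m - moment w p g.
  rewrite /moment {2}/m /expect mulr_suml -sumrB.
  by apply: eq_bigr => x _; ring.
by rewrite mp mul1r divff ?gt_eqF// subrr; lra.
Qed.

End EntropyLowerBound.

(** * The exponent curve of the product semigroup *)

Section Normalization.
Context {R : realType} {T : finType} (w : T -> R).
Hypotheses (w_gt0 : forall x, 0 < w x).
Implicit Types h : T -> R.

Lemma pnorm_moment (q : R) h : (forall x, 0 <= h x) -> pnorm w q h = moment w q h `^ q^-1.
Proof.
by move=> h0; congr (_ `^ _); apply: eq_bigr => x _; rewrite ger0_norm.
Qed.

Lemma moment_scale (q a : R) h : 0 <= a -> (forall x, 0 <= h x) ->
  moment w q (fun x => a * h x) = a `^ q * moment w q h.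
Proof.
move=> a0 h0; rewrite /moment /expect mulr_sumr; apply: eq_bigr => x _.
by rewrite powRM// mulrCA.
Qed.

Lemma pnorm_eqP (q c : R) h : 0 < c -> 0 < q -> (forall x, 0 <= h x) ->
  pnorm w q h = c <-> moment w q (fun x => c^-1 * h x) = 1.
Proof.
move=> c0 q0 h0; have qn0 : q != 0 by rewrite gt_eqF.
rewrite pnorm_moment// moment_scale ?invr_ge0 ?(ltW c0)//.
have cq : (c^-1 `^ q) * (c `^ q) = 1.
  by rewrite -powRM ?invr_ge0 ?(ltW c0)// mulVf ?gt_eqF// powR1.
split=> [Mc|M1].
  have -> : moment w q h = c `^ q.
    by rewrite -Mc -powRrM mulVf// powRr1// moment_ge0.
  exact: cq.
have -> : moment w q h = c `^ q.
  by rewrite -[LHS]mul1r -cq mulrAC M1 mul1r.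
by rewrite -powRrM divff// powRr1// ltW.
Qed.

End Normalization.

Section Velocity.
Context {R : realType} {X : finType} (L : X -> X -> R) (mu : X -> R) {n : nat}.
Hypothesis hL : is_generator L.
Hypotheses (mu_gt0 : forall z, 0 < mu z) (mu_sum : \sum_z mu z = 1).
Hypothesis mu_inv : forall z, \sum_x mu x * L x z = 0.
Hypothesis n_gt0 : (0 < n)%N.
Local Notation w := (@prod_measure R X n mu).

(** Let H = Ent(h^p) / n and x = E(h, h^(p-1)) / n.  The tensorized inequality
    says H <= Phi x, and the convexity bound says p rho / (p - 1) <= H.  Since
    b(y) / y is nondecreasing for the generalized inverse b of a concave gauge,
    x / H is at least b(y) / y at y = p rho / (p - 1). *)
Lemma velocity_lower_bound (p : R) (Phi : R -> R) (h : {ffun 'I_n -> X} -> R) :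
  1 < p -> lsi_gauge Phi -> admits_lsi L mu p Phi -> (forall x, 0 <= h x) ->
  moment w p h = 1 -> 0 < expect w h < 1 -> 0 < log_moment w p h ->
  forall rho : R, rho = n%:R^-1 * - ln (expect w h) ->
  ((p * (p - 1) / rho)%:E * lsi_inverse Phi (p * rho / (p - 1)) <=
   (p * prod_dirichlet L mu p h / log_moment w p h)%:E)%E.
Proof.
move=> p1 hPhi lsi h0 mp /andP[m0 m1] lm0 rho rhoE.
have w_gt0 x : 0 < w x by apply: prodr_gt0.
have nR : 0 < n%:R :> R by rewrite ltr0n.
have p0 : 0 < p by lra.
have pm1 : 0 < p - 1 by lra.
have rho0 : 0 < rho.
  by rewrite rhoE mulr_gt0 ?invr_gt0// oppr_gt0 ln_lt0// m0.
have ent : entropy w (fun x => h x `^ p) = p * log_moment w p h.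
  rewrite /entropy -/(moment w p h) mp /log_moment /expect mulr_sumr.
  by apply: eq_bigr => x _; rewrite divr1 ln_powR; ring.
have := lsi_tensorization hL mu_gt0 mu_sum mu_inv p1 hPhi lsi h0.
rewrite ent mp mulr1; set D := prod_dirichlet L mu p h => tens.
have D0 : 0 <= D.
  rewrite /D prod_dirichletE//; apply: sumr_ge0 => i _; apply: sumr_ge0 => x _.
  by rewrite mulr_ge0 ?(ltW (w_gt0 x))//; exact: dirichlet_ge0.
have lower := log_moment_ge w_gt0 p1 h0 mp m0.
set l := log_moment w p h in lm0 tens lower *.
have H1 : p * l / n%:R <= Phi (D / n%:R) by rewrite ler_pdivrMr// [leRHS]mulrC.
have y0 : 0 < p * rho / (p - 1) by rewrite divr_gt0// mulr_gt0.
have yH : p * rho / (p - 1) <= p * l / n%:R.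
  have -> : p * rho / (p - 1) = p / n%:R / (p - 1) * - ln (expect w h).
    by rewrite rhoE; field; rewrite !gt_eqF.
  have -> : p * l / n%:R = p / n%:R / (p - 1) * ((p - 1) * l).
    by field; rewrite !gt_eqF.
  by rewrite ler_pM2l// !divr_gt0.
have E0 : 0 <= D / n%:R by rewrite divr_ge0// ltW.
have yI : 0 < p * rho / (p - 1) <= p * l / n%:R by rewrite y0.
have := lsi_inverse_le hPhi E0 yI H1.
have K0 : (0 <= (p * (p - 1) / rho)%:E)%E.
  by rewrite lee_fin divr_ge0 ?mulr_ge0// ltW.
move=> /(lee_wpmul2l K0) h1; apply: le_trans h1 _; rewrite -EFinM lee_fin.
rewrite le_eqVlt; apply/orP; left; apply/eqP.
by field; rewrite !gt_eqF.
Qed.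

End Velocity.

Theorem theorem3 (R : realType) (X : finType) (L : X -> X -> R) (mu : X -> R)
    (hL : is_generator L) (hirr : irreducible L)
    (hmu : is_prob mu) (hstat : stationary L mu)
    (n : nat) (hn : (0 < n)%N)
    (f : {ffun 'I_n -> X} -> R) (hf0 : forall x, 0 <= f x)
    (hf : ~ exists c : R, forall x, f x = c)
    (p0 : R) (hp0 : 1 < p0) :
  let norm (p : R) (g : {ffun 'I_n -> X} -> R) := pnorm (prod_measure mu) p g in
  let solves (t0 : R) (q : R -> R) :=
    forall t, 0 <= t < t0 ->
      0 < q t /\ norm (q t) (prod_semigroup L t f) = norm p0 f in
  let rho0 : R := n%:R^-1 * ln (norm p0 f / norm 1 f) in
  exists (t0 : R) (p : R -> R),
    [/\ 0 < t0,
        solves t0 p /\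
          (forall q : R -> R, solves t0 q -> forall t, 0 <= t < t0 -> q t = p t),
        [/\ smooth_on `]0, t0[ p,
            Ck_on 1%N `[0, t0[ p &
            (forall x, 0 < f x) -> smooth_on `[0, t0[ p],
        [/\ p 0 = p0,
            {in `[0, t0[ &, {homo p : s t / s < t}} &
            p @` `[0, t0[ = `[p0, +oo[%classic] &
        forall Phi : R -> R -> R,
          (forall p', p0 <= p' -> lsi_gauge (Phi p') /\ admits_lsi L mu p' (Phi p')) ->
          forall t, 0 <= t < t0 ->
            ((p t * (p t - 1) / rho0)%:E *
               lsi_inverse (Phi (p t)) (p t * rho0 / (p t - 1))
             <= (derive_within `[0, t0[ p t)%:E)%E].
Proof.
move=> norm solves rho0; have [mu_ge0 mu_sum] := hmu.
have mu_gt0 := stationary_gt0 hL hirr hmu hstat.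
have mu_inv := stationary_generator hstat.
pose w := @prod_measure R X n mu.
have w_gt0 : forall x, 0 < w x := prod_measure_gt0 hL hirr hmu hstat.
have w_sum : \sum_x w x = 1 := prod_measure_sum hmu.
pose c := norm p0 f.
have [x0 fx0] := nonconst_neq hf 0.
have mom_gt0 (q : R) : 0 < moment w q f.
  rewrite /moment /expect (bigD1 x0)//= ltr_pwDl//.
    by rewrite mulr_gt0// powR_gt0// lt_neqAle eq_sym fx0 hf0.
  by apply: sumr_ge0 => x _; rewrite mulr_ge0 ?powR_ge0// ltW.
have c_gt0 : 0 < c by rewrite /c /norm pnorm_moment// powR_gt0.
have p0_gt0 : 0 < p0 := lt_trans ltr01 hp0.
(* The normalized function g = f / c has moment 1 at p0 and evolves to u. *)
pose g x := c^-1 * f x; pose u t := prod_semigroup L t g.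
have uE t : u t = fun x => c^-1 * prod_semigroup L t f x by exact: prod_semigroupZ.
have g_ge0 x : 0 <= g x by rewrite mulr_ge0// invr_ge0 ltW.
have g_nonconst : ~ exists a : R, forall x, g x = a.
  by move=> [a ga]; apply: hf; exists (c * a) => x; rewrite -(ga x) mulVKf// gt_eqF.
have u_ge0 (t : R) : 0 <= t -> forall x, 0 <= u t x by exact: prod_semigroup_ge0.
have u_gt0 (t : R) : 0 < t -> forall x, 0 < u t x by exact: prod_semigroup_gt0.
have u_nonconst (t : R) : 0 <= t -> ~ exists a, forall x, u t x = a.
  by move=> _; exact: prod_semigroup_nonconst.
have u_derive (t : R) x : is_derive t (1 : R) (u ^~ x) (\sum_y prod_generator L x y * u t y).
  exact: prod_semigroup_derive.
have u_dec (s t q : R) : 0 <= s < t -> 1 < q -> moment w q (u t) < moment w q (u s).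
  exact: (prod_moment_decreasing hL hirr hmu hstat).
have u0 : u 0 = g by exact: prod_semigroup0.
have u_init : moment w p0 (u 0) = 1 by rewrite u0; apply/pnorm_eqP.
have mean1 : expect w g = moment w 1 g.
  by apply: eq_bigr => x _; rewrite powRr1.
have mean_lt1 : expect w g < 1.
  rewrite mean1 ltNge; apply/negP => m1.
  have := @moment_gt1 _ _ w w_gt0 w_sum 1 p0 g g_ge0 g_nonconst.
  by rewrite ltr01 hp0 => /(_ isT m1); rewrite -u0 u_init ltxx.
have mean_gt0 : 0 < expect w g.
  rewrite mean1 moment_scale ?invr_ge0 ?(ltW c_gt0)// mulr_gt0//.
  by rewrite powR_gt0 ?invr_gt0.
have [t1 t1_ge0 u_small] := prod_semigroup_eventually_lt hL hirr hmu hstat mean_lt1.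
have [t0 [p [t0_gt0 p_spec p_surj]]] := exponent_exists w_gt0 w_sum u_ge0 u_nonconst
  u_derive u_dec hp0 u_init t1_ge0 u_small.
have slope := exponent_slope w_gt0 w_sum u_ge0 u_gt0 u_nonconst u_derive u_dec hp0 p_spec p_surj.
have mono := exponent_increasing w_gt0 w_sum u_ge0 u_nonconst u_dec hp0 p_spec.
have smooth := exponent_smooth w_gt0 w_sum u_ge0 u_gt0 u_nonconst u_derive u_dec hp0 p_spec p_surj.
have velC := exponent_velocity_continuous w_gt0 w_sum u_ge0 u_nonconst u_derive u_dec hp0
  p_spec p_surj.
have lm_gt0 := exponent_log_moment_gt0 w_gt0 w_sum u_ge0 u_nonconst hp0 p_spec.
pose I : set R := `[0, t0[%classic.
have IP (t : R) : I t = (0 <= t < t0) by rewrite /I/= in_itv.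
have lim_co (t : R) : I t -> ProperFilter (within I t^').
  rewrite IP => tI; apply: (interval_limit_point (a := 0) (b := t0)) => //.
  by move=> s; rewrite IP /= in_itv/= => /andP[/ltW-> ->].
have lim_oo (t : R) : `]0, t0[%classic t -> ProperFilter (within `]0, t0[ t^').
  rewrite /= in_itv/= => /andP[tgt0 tt0].
  by apply: (interval_limit_point (a := 0) (b := t0)) => //; rewrite (ltW tgt0).
have norm_u (q t : R) : 0 < q -> 0 <= t ->
    norm q (prod_semigroup L t f) = norm p0 f <-> moment w q (u t) = 1.
  by move=> q0 t_ge0; rewrite uE; apply: pnorm_eqP => //; exact: prod_semigroup_ge0.
have p_init : p 0 = p0.
  have I0 : 0 <= (0 : R) < t0 by rewrite lexx t0_gt0.
  have [p0p N1] := p_spec 0 I0.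
  exact: (moment_inj w_gt0 w_sum (u_ge0 0 (lexx 0)) (u_nonconst 0 (lexx 0))
    (lt_le_trans p0_gt0 p0p) p0_gt0 N1 u_init).
exists t0, p; split; first exact: t0_gt0.
- split=> [t tI|q qs t tI].
    have [p0p N1] := p_spec t tI; have pt0 : 0 < p t := lt_le_trans p0_gt0 p0p.
    have /andP[t_ge0 _] := tI; split; first exact: pt0.
    exact: (norm_u _ _ pt0 t_ge0).2 N1.
  have [p0p N1] := p_spec t tI; have pt0 : 0 < p t := lt_le_trans p0_gt0 p0p.
  have /andP[t_ge0 _] := tI; have [q0 /(norm_u _ _ q0 t_ge0) Nq] := qs t tI.
  exact: (moment_inj w_gt0 w_sum (u_ge0 t t_ge0) (u_nonconst t t_ge0) q0 pt0 Nq N1).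
- split.
  + apply: smooth => //.
      by move=> s /=; rewrite !in_itv/= => /andP[/ltW-> ->].
    by move=> t x /=; rewrite in_itv/= => /andP[tgt0 _]; exact: u_gt0.
  + by apply/CkSP => //; exists (exponent_velocity w u (prod_generator L) p).
  + move=> f_gt0; apply: smooth => // t x; rewrite /= in_itv/= => /andP[+ _].
    rewrite le_eqVlt => /predU1P[<-|]; last by move=> ?; exact: u_gt0.
    by rewrite u0 mulr_gt0// invr_gt0.
- split; first exact: p_init.
  + by move=> s t; rewrite !in_itv/=; exact: mono.
  + apply/seteqP; split => [_ [t tI <-]|q].
      move: tI; rewrite /= in_itv/= => tI; have [p0p _] := p_spec t tI.
      by rewrite /= in_itv/= p0p.
    rewrite /= in_itv/= andbT => p0q; have [t tI <-] := p_surj q p0q.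
    by exists t => //; rewrite /= in_itv.
- move=> Phi hPhi t tI; have [p0p N1] := p_spec t tI; have /andP[t_ge0 _] := tI.
  have [gauge lsi] := hPhi _ p0p.
  have tI' : I t by rewrite IP.
  have [_ ->] := has_slope_derive_within lim_co tI' (slope t tI).
  have mean_u : expect w (u t) = expect w g by exact: (expect_prod_semigroup hstat g t_ge0).
  have mean_f : expect w g = norm 1 f / norm p0 f.
    rewrite mean1 moment_scale ?invr_ge0 ?(ltW c_gt0)// powRr1 ?invr_ge0 ?(ltW c_gt0)//.
    rewrite mulrC; congr (_ / _); rewrite [RHS]pnorm_moment// invr1 powRr1//.
    exact/ltW/mom_gt0.
  have n1_gt0 : 0 < norm 1 f by rewrite /norm (pnorm_moment _ 1 hf0); apply: powR_gt0; exact: mom_gt0.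
  have rho0E : rho0 = n%:R^-1 * - ln (expect w (u t)).
    rewrite /rho0 mean_u mean_f -lnV ?invf_div; first by [].
    by rewrite posrE; apply: divr_gt0; [exact: n1_gt0|exact: c_gt0].
  have pt1 : 1 < p t := lt_le_trans hp0 p0p.
  have mean01 : 0 < expect w (u t) < 1 by rewrite mean_u mean_gt0.
  have := velocity_lower_bound hL mu_gt0 mu_sum mu_inv hn pt1 gauge lsi (u_ge0 t t_ge0) N1
    mean01 (lm_gt0 t tI) rho0E.
  move=> h; apply: le_trans h _; rewrite lee_fin le_eqVlt; apply/orP; left; apply/eqP.
  by rewrite /exponent_velocity /moment_rate /prod_dirichlet mulrN.
Qed.
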